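(* Let $n\ge 2$. The quotient space $\mathcal{M}=\mathcal{M}'/\!\sim$ of the marked moduli space $\mathcal{M}'$ by the involution $(f,c_1,c_2)\leftrightarrow(f,c_2,c_1)$ interchanging the two critical points, which consists of all holomorphic conjugacy classes of bicritical rational maps of degree $n$, is biholomorphic to $\mathbb{C}^2$, with coordinates $X$ and $Y=Y_1+Y_2$.
   Context: A rational map $f:\widehat{\mathbb{C}}\to\widehat{\mathbb{C}}$ of degree $n\ge2$ is bicritical if it has exactly two critical points. Two rational maps $f,g$ are holomorphically conjugate if $g=\phi\circ f\circ\phi^{-1}$ for some Möbius automorphism $\phi$ of $\widehat{\mathbb{C}}$. The marked moduli space $\mathcal{M}'$ is the set of conjugacy classes of triples $(f,c_1,c_2)$, where $f$ is bicritical of degree $n$ with numbered critical points $c_1,c_2$, the class of $(f,c_1,c_2)$ being the set of all $(\phi\circ f\circ\phi^{-1},\phi(c_1),\phi(c_2))$ with $\phi$ Möbius. Every such triple is conjugate to one with $c_1=\infty$, $c_2=0$ and $$f(z)=\frac{az^n+b}{cz^n+d},\qquad ad-bc\neq0,$$ and the quantities $$X=\frac{bc}{ad-bc},\qquad Y_1=\frac{a^{n+1}b^{n-1}}{(ad-bc)^n},\qquad Y_2=\frac{c^{n-1}d^{n+1}}{(ad-bc)^n}$$ depend only on the marked conjugacy class. They identify $\mathcal{M}'$ with the affine variety $\{(X,Y_1,Y_2)\in\mathbb{C}^3: Y_1Y_2=X^{n-1}(X+1)^{n+1}\}$; the involution interchanging the critical points acts by $(X,Y_1,Y_2)\mapsto(X,Y_2,Y_1)$,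 and $\mathcal{M}$ is given the structure of quotient variety. *)

(* Defs.v *)
From HB Require Import structures.
From mathcomp Require Import all_boot all_order all_algebra.
From mathcomp Require Import all_classical all_reals all_analysis.
From mathcomp Require Import complex.
From mathcomp Require mpoly.

Set Implicit Arguments.
Unset Strict Implicit.
Unset Printing Implicit Defensive.

Import Order.TTheory GRing.Theory Num.Theory.
Import numFieldNormedType.Exports.
Local Open Scope classical_set_scope.
Local Open Scope ring_scope.

(* The complex numbers; the ascription makes the norm topology and the
   C-linear notion of differentiability of normed modules available. *)
Definition Cplx (R : realType) : numClosedFieldType := R[i].

Section RationalMaps.
Variable R : realType.
Local Notation C := (Cplx R).

(* The Riemann sphere: [None] is the point at infinity. *)
Definition sphere : Type := option C.
Definition infty : sphere := None.
Definition origin : sphere := Some 0.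

(* The self-map p/q of the sphere, for coprime p and q.  At infinity one
   compares the coefficients of degree max(deg p, deg q). *)
Definition ratfun (p q : {poly C}) (z : sphere) : sphere :=
  match z with
  | Some w => if q.[w] == 0 then None else Some (p.[w] / q.[w])
  | None => let m := (maxn (size p) (size q)).-1 in
            if q`_m == 0 then None else Some (p`_m / q`_m)
  end.

Definition rational_map (n : nat) (f : sphere -> sphere) : Prop :=
  exists p q : {poly C},
    [/\ coprimep p q, (maxn (size p) (size q)).-1 = n & f = ratfun p q].

(* Local coordinate centred at z (z - a at a finite point a, 1/z at infinity)
   and the corresponding local parametrization.  The value 0 that [chart]
   takes at the antipodal points (infinity, resp. 0) is irrelevant, as only
   germs at the centre are used. *)
Definition chart (z w : sphere) : C :=
  match z, w with
  | Some a, Some b => b - a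
  | Some _, None => 0
  | None, Some b => b^-1
  | None, None => 0
  end.

Definition param (z : sphere) (t : C) : sphere :=
  match z with
  | Some a => Some (a + t)
  | None => if t == 0 then None else Some t^-1
  end.

Definition critical_point (f : sphere -> sphere) (z : sphere) : Prop :=
  is_derive (0 : C) (1 : C) (chart (f z) \o f \o param z : C -> C) (0 : C).

Definition bicritical (n : nat) (f : sphere -> sphere) : Prop :=
  rational_map n f /\
  exists c1 c2 : sphere, c1 <> c2 /\
    forall z, critical_point f z <-> z = c1 \/ z = c2.

Definition mobius (phi : sphere -> sphere) : Prop :=
  exists a b c d : C, a * d - b * c != 0 /\
    phi = ratfun (a *: 'X + b%:P) (c *: 'X + d%:P).

Definition hol_class (f : sphere -> sphere) : set (sphere -> sphere) :=
  [set g | exists phi psi : sphere -> sphere,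
     [/\ mobius phi, cancel phi psi, cancel psi phi & g = phi \o f \o psi]].

Definition hol_classes (n : nat) : set (set (sphere -> sphere)) :=
  [set hol_class f | f in [set f | bicritical n f]].

Definition triple : Type := ((sphere -> sphere) * sphere * sphere)%type.

Definition marked_bicritical (n : nat) (t : triple) : Prop :=
  let: (f, c1, c2) := t in
  [/\ rational_map n f, c1 <> c2 &
      forall z, critical_point f z <-> z = c1 \/ z = c2].

Definition marked_class (t : triple) : set triple :=
  let: (f, c1, c2) := t in
  [set t' | exists phi psi : sphere -> sphere,
     [/\ mobius phi, cancel phi psi, cancel psi phi &
         t' = (phi \o f \o psi, phi c1, phi c2)]].

(* The marked moduli space M'. *)
Definition marked_moduli (n : nat) : set (set triple) :=
  [set marked_class t | t in [set t | marked_bicritical n t]].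

Definition swap_marking (t : triple) : triple :=
  let: (f, c1, c2) := t in (f, c2, c1).

(* The orbit of a marked class under the involution. *)
Definition marking_orbit (K : set triple) : set (set triple) :=
  [set K; swap_marking @` K].

(* The quotient M = M'/~; [marking_orbit] is the quotient map. *)
Definition moduli (n : nat) : set (set (set triple)) :=
  marking_orbit @` marked_moduli n.

(* The maps underlying the marked maps of an orbit. *)
Definition underlying (m : set (set triple)) : set (sphere -> sphere) :=
  [set f | exists K c1 c2, m K /\ K (f, c1, c2)].

Definition normal_form (n : nat) (a b c d : C) : sphere -> sphere :=
  ratfun (a *: 'X^n + b%:P) (c *: 'X^n + d%:P).

(* The value of e(a,b,c,d) on any representative in normal form of the
   marked class K; for the three expressions below it does not depend on the
   representative. *)
Definition normal_value (n : nat) (e : C -> C -> C -> C -> C)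
    (K : set triple) : C :=
  xget 0 [set x | exists a b c d : C,
    [/\ a * d - b * c != 0, K (normal_form n a b c d, infty, origin) &
        x = e a b c d]].

Definition coordX (n : nat) : set triple -> C :=
  normal_value n (fun a b c d => (b * c) / (a * d - b * c)).
Definition coordY1 (n : nat) : set triple -> C :=
  normal_value n (fun a b c d =>
    (a ^+ n.+1 * b ^+ n.-1) / (a * d - b * c) ^+ n).
Definition coordY2 (n : nat) : set triple -> C :=
  normal_value n (fun a b c d =>
    (c ^+ n.-1 * d ^+ n.+1) / (a * d - b * c) ^+ n).

(* The structure of M' as an affine variety, transported from its image in
   C^3: its (analytic) open sets and its regular functions. *)
Definition marked_open (n : nat) (W : set (set triple)) : Prop :=
  exists O : set (C * C * C), open O /\
    W = marked_moduli n `&`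
        [set K | O (coordX n K, coordY1 n K, coordY2 n K)].

Definition marked_regular (n : nat) (h : set triple -> C) : Prop :=
  exists P : mpoly.mpoly 3 C, forall K, marked_moduli n K ->
    h K = mpoly.meval (tnth [tuple coordX n K; coordY1 n K; coordY2 n K]) P.

(* The structure of quotient variety on M: the quotient topology, and as
   regular functions the invariant regular functions on M'. *)
Definition moduli_open (n : nat) (U : set (set (set triple))) : Prop :=
  U `<=` moduli n /\ marked_open n (marked_moduli n `&` marking_orbit @^-1` U).

Definition moduli_regular (n : nat) (h : set (set triple) -> C) : Prop :=
  marked_regular n (h \o marking_orbit).

(* The complex analytic structure of the variety M: a function is holomorphic
   if locally it is a holomorphic function of finitely many regular ones. *)
Definition moduli_holomorphic (n : nat) (U : set (set (set triple)))
    (h : set (set triple) -> C) : Prop :=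
  forall m, U m ->
  exists (V : set (set (set triple))) (k : nat)
         (r : 'I_k -> set (set triple) -> C)
         (O : set 'rV[C]_k) (H : 'rV[C]_k -> C),
    [/\ moduli_open n V, V m & V `<=` U] /\
    [/\ forall i, moduli_regular n (r i), open O,
        forall x, O x -> differentiable H x &
        forall m', V m' -> O (\row_i r i m') /\ h m' = H (\row_i r i m')].

Definition holomorphic2 (U : set (C * C)) (g : C * C -> C) : Prop :=
  forall x, U x -> differentiable g x.

(* F is a biholomorphic map of M onto C^2: a homeomorphism which identifies
   the holomorphic functions on open sets.  As F is bijective, every function
   on M is of the form g \o F. *)
Definition biholomorphic_C2 (n : nat) (F : set (set triple) -> C * C) : Prop :=
  [/\ set_bij (moduli n) setT F,
      forall U, U `<=` moduli n -> (moduli_open n U <-> open (F @` U)) &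
      forall U g, moduli_open n U ->
        (moduli_holomorphic n U (g \o F) <-> holomorphic2 (F @` U) g)].

End RationalMaps.

(* Main.v *)
(* In homogeneous coordinates a rational map of degree n is a pair of binary forms
   of degree n without common zero.  If all critical points are 0 and infinity, the
   Wronskian p'q - pq' is a monomial k z^m; comparing the vanishing order at 0 of
   q(0) p - p(0) q and the degree of q_n p - p_n q with m forces p and q to be
   combinations of z^n and 1.  Two normal forms with the same marking are conjugate
   iff they differ by a scaling z -> l z, and solving for l shows that (X, Y1, Y2)
   is a complete invariant with image Y1 Y2 = X^(n-1) (X+1)^(n+1).  As Y1 and Y2 are
   the roots of T^2 - Y T + X^(n-1) (X+1)^(n+1), the pair (X, Y) determines the
   unordered pair {Y1, Y2}.  Continuity of the roots gives the topology, and since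
   symmetric polynomials in Y1, Y2 are polynomials in Y1 + Y2 and Y1 Y2, every
   regular function on the quotient is a polynomial in (X, Y). *)
From HB Require Import structures.
Require Import Defs.
From mathcomp Require Import all_boot all_order all_algebra.
From mathcomp Require Import all_classical all_reals all_analysis.
From mathcomp Require Import complex ring.
From mathcomp Require mpoly.
Import Order.TTheory GRing.Theory Num.Theory.
Import numFieldNormedType.Exports.
Local Open Scope classical_set_scope.
Local Open Scope ring_scope.

Set Implicit Arguments.
Unset Strict Implicit.
Unset Printing Implicit Defensive.

(** * Rational maps in homogeneous coordinates *)

(** Points, charts and values at infinity are all defined by cases. Homogeneous coordinates remove
    the cases: composing with a Möbius map on either side is a linear substitution, and at every
    point, infinity included, criticality is the vanishing of a Wronskian of two local polynomials.
    The exponents in Y1 and Y2 come from the scaling z -> l z, which multiplies (a, b, c, d) by (l,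
    l^(n+1), 1, l^n) up to a common factor. If Y1 is nonzero, one can normalize b = 1 and
    determinant 1; then c = X and a^(n+1) = Y1, so the invariants leave only the choice of a root.
    This breaks down at Y1 = 0. Interchanging the critical points rescues the case where Y2 is
    nonzero; the points with Y1 = Y2 = 0 are the classes of z^n (X = 0) and z^(-n) (X = -1), where l
    is found as a root of order n - 1 and n + 1 respectively. A regular function on the quotient
    comes from a polynomial in X, Y1, Y2 that need not be symmetric, so it is averaged over the
    involution before it is rewritten in X and Y. *)

Lemma coef_top_mul (F : nzRingType) m n (p q : {poly F}) : (size p <= m.+1)%N -> (size q <= n.+1)%N ->
  (p * q)`_(m + n) = p`_m * q`_n.
Proof.
move=> sp sq; rewrite coefM (bigD1 (Ordinal (leq_addr n m : m < (m + n).+1)%N)) //=.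
(* Every term of the convolution other than i = m has a factor beyond its size bound. *)
rewrite addKn big1 ?addr0 // => i /eqP im.
have [lim|] := ltnP i m; last rewrite leq_eqVlt => /predU1P[mi|lmi].
- rewrite [q`_ _]nth_default ?mulr0 //; apply: leq_trans sq _.
  by rewrite ltn_subRL ltn_add2r.
- by case: im; apply: val_inj.
- by rewrite [p`_ _]nth_default ?mul0r //; apply: leq_trans sp lmi.
Qed.

Lemma size_poly_mul_le (F : nzRingType) m n (p q : {poly F}) : (size p <= m.+1)%N -> (size q <= n.+1)%N ->
  (size (p * q)%R <= (m + n).+1)%N.
Proof.
move=> sp sq; apply: leq_trans (size_polyMleq _ _) _.
by rewrite -subn1 leq_subLR (leq_trans (leq_add sp sq)) // addSn addnS.
Qed.

Section HomogeneousCoordinates.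
Variable R : realType.
Local Notation C := (Cplx R).
Implicit Types (a b c d u v k w : C) (p q : {poly C}) (z : sphere R).

(* The point [u : v] of the sphere, seen as the projective line. *)
Definition pt u v : sphere R := if v == 0 then None else Some (u / v).

(** [pt 0 0] is infinity as well, so the pair (0, 0) has to be excluded separately. *)
Definition nz2 u v : bool := (u != 0) || (v != 0).

Lemma nz2P u v : reflect (u = 0 -> v = 0 -> False) (nz2 u v).
Proof.
rewrite /nz2; case: eqP => [->|u0] /=; last by constructor => /u0.
by case: eqP => [->|v0]; constructor => // /(_ erefl erefl).
Qed.

Lemma pt_scale k u v : k != 0 -> pt (k * u) (k * v) = pt u v.
Proof.
move=> k0; rewrite /pt mulf_eq0 (negbTE k0) /=; case: eqP => // /eqP v0.
by congr Some; field; rewrite k0 v0.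
Qed.

Lemma ptP z : exists u v, nz2 u v /\ z = pt u v.
Proof.
case: z => [w|]; first by exists w, 1; rewrite /nz2 oner_neq0 orbT /pt oner_eq0 divr1.
by exists 1, 0; rewrite /nz2 oner_neq0 /pt eqxx.
Qed.

Lemma pt_inj u v u' v' : nz2 u v -> nz2 u' v' -> pt u v = pt u' v' ->
  exists2 k, k != 0 & u' = k * u /\ v' = k * v.
Proof.
rewrite /pt => h h'; case: eqP => [v0|/eqP v0]; case: eqP => [v0'|/eqP v0'] //.
  move=> _; move: h h'; rewrite /nz2 v0 v0' eqxx !orbF => u0 u0'.
  by exists (u' / u); rewrite ?mulf_neq0 ?invr_neq0 // mulr0 divfK.
case=> e; exists (v' / v); first by rewrite mulf_neq0 ?invr_neq0.
split; last by rewrite divfK.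
by rewrite -[u'](divfK v0') -e; field.
Qed.

(* The binary form of degree n with dehomogenization p. *)
Definition bform n p u v : C := \sum_(i < n.+1) p`_i * (u ^+ i * v ^+ (n - i)).

Lemma bformE n p u v : (size p <= n.+1)%N ->
  bform n p u v = if v == 0 then p`_n * u ^+ n else v ^+ n * p.[u / v].
Proof.
move=> sp; case: eqP => [->|/eqP v0].
  rewrite /bform big_ord_recr /= subnn mulr1 big1 ?add0r // => i _.
  by rewrite expr0n subn_eq0 leqNgt ltn_ord /= mulr0 mulr0.
rewrite (horner_coef_wide _ sp) /bform mulr_sumr; apply: eq_bigr => i _.
have -> : v ^+ n = v ^+ i * v ^+ (n - i) by rewrite -exprD subnKC // -ltnS.
by rewrite exprMn exprVn; field; rewrite expf_neq0.
Qed.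

Lemma bform_aff n p w : (size p <= n.+1)%N -> bform n p w 1 = p.[w].
Proof. by move=> sp; rewrite bformE // oner_eq0 expr1n mul1r divr1. Qed.

Lemma bform_inf n p : bform n p 1 0 = p`_n.
Proof.
rewrite /bform big_ord_recr /= subnn !expr1n !mulr1 big1 ?add0r // => i _.
by rewrite expr0n subn_eq0 leqNgt ltn_ord /= mulr0 mulr0.
Qed.

Lemma bform_lin n p q a b u v :
  bform n (a *: p + b *: q) u v = a * bform n p u v + b * bform n q u v.
Proof.
rewrite /bform !mulr_sumr -big_split; apply: eq_bigr => i _ /=.
by rewrite coefD !coefZ; ring.
Qed.

Lemma bform_mul m n p q u v : (size p <= m.+1)%N -> (size q <= n.+1)%N ->
  bform (m + n) (p * q) u v = bform m p u v * bform n q u v.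
Proof.
move=> sp sq; rewrite !bformE //; last exact: size_poly_mul_le.
case: eqP => _; last by rewrite hornerM exprD; ring.
by rewrite coef_top_mul // exprD; ring.
Qed.

(** The absence of a common zero at infinity says that the larger degree is exactly n. One condition
    thus replaces coprimality together with the degree, and it is stable under linear substitutions
    on both sides. *)
Definition nondeg n p q := [/\ (size p <= n.+1)%N, (size q <= n.+1)%N &
  forall u v, nz2 u v -> nz2 (bform n p u v) (bform n q u v)].

Lemma nondeg_horner n p q w : nondeg n p q -> nz2 p.[w] q.[w].
Proof.
by case=> sp sq /(_ w 1); rewrite !bform_aff // /nz2 oner_neq0 orbT; apply.
Qed.

Lemma nondeg_top n p q : nondeg n p q -> nz2 p`_n q`_n.
Proof. by case=> sp sq /(_ 1 0); rewrite !bform_inf // /nz2 oner_neq0; apply. Qed.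

Lemma nondeg_size n p q : nondeg n p q -> (maxn (size p) (size q)).-1 = n.
Proof.
move=> h; have := nondeg_top h; case: h => sp sq _ h.
suff -> : maxn (size p) (size q) = n.+1 by [].
apply/eqP; rewrite eqn_leq geq_max sp sq /= leq_max !ltnNge -negb_and.
apply: contraL h => /andP [lp lq].
by rewrite /nz2 !nth_default // eqxx.
Qed.

Lemma nondeg_coprime n p q : nondeg n p q -> coprimep p q.
Proof.
move=> h; apply: Pdiv.ClosedField.root_coprimep => x /eqP px.
by have := nondeg_horner x h; rewrite /nz2 px eqxx.
Qed.

Lemma coprime_nondeg n p q : (0 < n)%N ->
  coprimep p q -> (maxn (size p) (size q)).-1 = n -> nondeg n p q.
Proof.
(* The predecessor identifies sizes 0 and 1; since 0 < n, the larger size is exactly [n.+1]. *)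
move=> n0 cpq e; have {}e : maxn (size p) (size q) = n.+1 by case: maxn e n0 => [|m] <-.
have sp : (size p <= n.+1)%N by rewrite -e leq_maxl.
have sq : (size q <= n.+1)%N by rewrite -e leq_maxr.
split=> // u v huv; rewrite !bformE //; apply/nz2P; case: eqP => [v0|/eqP v0].
  have u0 : u != 0 by move: huv; rewrite /nz2 v0 eqxx orbF.
  move=> /eqP; rewrite mulf_eq0 expf_eq0 (negbTE u0) andbF orbF => /eqP pn.
  move=> /eqP; rewrite mulf_eq0 expf_eq0 (negbTE u0) andbF orbF => /eqP qn.
  move: e; rewrite /maxn; case: ifP => _ e.
    have := lead_coef_eq0 q; rewrite /lead_coef e /= qn eqxx => /esym/eqP q0.
    by move: e; rewrite q0 size_poly0.
  have := lead_coef_eq0 p; rewrite /lead_coef e /= pn eqxx => /esym/eqP q0.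
  by move: e; rewrite q0 size_poly0.
move=> /eqP; rewrite mulf_eq0 expf_eq0 (negbTE v0) andbF /= => pr.
move=> /eqP; rewrite mulf_eq0 expf_eq0 (negbTE v0) andbF /= => /eqP qr.
by have := Pdiv.ClosedField.coprimepP _ _ cpq _ pr; rewrite qr eqxx.
Qed.

Lemma rational_nondeg n (f : sphere R -> sphere R) : (0 < n)%N ->
  rational_map n f <-> exists p q, nondeg n p q /\ f = ratfun p q.
Proof.
move=> n0; split=> [[p [q [cpq spq ->]]]|[p [q [h ->]]]]; exists p, q.
  by split => //; apply: coprime_nondeg.
by split => //; [apply: nondeg_coprime h|apply: nondeg_size].
Qed.

(** The bridge from the case distinction of [ratfun] to forms: numerator and denominator share the
    factor u^n or v^n, which cancels in [pt]. *)
Lemma ratfun_pt n p q u v : nondeg n p q -> nz2 u v ->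
  ratfun p q (pt u v) = pt (bform n p u v) (bform n q u v).
Proof.
move=> h huv; have sn := nondeg_size h; case: h => sp sq h.
rewrite /pt; case: (eqVneq v 0) => [v0|v0] /=.
  have u0 : u != 0 by move: huv; rewrite /nz2 v0 eqxx orbF.
  rewrite -/(pt (bform n p u v) (bform n q u v)) !bformE // v0 eqxx sn.
  by rewrite ![_ * u ^+ n]mulrC pt_scale // expf_neq0.
rewrite -/(pt (bform n p u v) (bform n q u v)) !bformE // (negbTE v0).
by rewrite pt_scale // expf_neq0.
Qed.

Definition lin a b : {poly C} := a *: 'X + b%:P.
Definition mob a b c d : sphere R -> sphere R := ratfun (lin a b) (lin c d).

Lemma bform_lin1 a b u v : bform 1 (lin a b) u v = a * u + b * v.
Proof.
rewrite /bform /lin !big_ord_recr big_ord0 /= add0r !coefD !coefZ !coefX !coefC /=.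
by rewrite !expr0 !expr1; ring.
Qed.

Lemma size_lin a b : (size (lin a b) <= 2)%N.
Proof.
rewrite (leq_trans (size_polyD _ _)) // geq_max (leq_trans (size_scale_leq _ _)) ?size_polyX //.
by rewrite (leq_trans (size_polyC_leq1 _)).
Qed.

(** Cramer's rule: the determinant times u or v is a combination of the two new coordinates. *)
Lemma lin_nz2 a b c d u v : a * d - b * c != 0 -> nz2 u v ->
  nz2 (a * u + b * v) (c * u + d * v).
Proof.
move=> D h; apply/nz2P => e1 e2; move/nz2P: h; apply; apply/(mulfI D); rewrite mulr0.
  have -> : (a * d - b * c) * u = d * (a * u + b * v) - b * (c * u + d * v) by ring.
  by rewrite e1 e2; ring.
have -> : (a * d - b * c) * v = a * (c * u + d * v) - c * (a * u + b * v) by ring.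
by rewrite e1 e2; ring.
Qed.

Lemma nondeg_lin a b c d : a * d - b * c != 0 -> nondeg 1 (lin a b) (lin c d).
Proof.
by move=> D; split; rewrite ?size_lin // => u v h; rewrite !bform_lin1; exact: lin_nz2.
Qed.

Lemma mob_pt a b c d u v : a * d - b * c != 0 -> nz2 u v ->
  mob a b c d (pt u v) = pt (a * u + b * v) (c * u + d * v).
Proof. by move=> D h; rewrite /mob (ratfun_pt (nondeg_lin D)) // !bform_lin1. Qed.

Lemma mob_scalar k : k != 0 -> mob k 0 0 k = id.
Proof.
move=> k0; apply/funext => z; have [u [v [h ->]]] := ptP z.
have D : k * k - 0 * 0 != 0 by rewrite mul0r subr0 mulf_neq0.
by rewrite mob_pt // !mul0r addr0 add0r pt_scale.
Qed.

Lemma mob_comp a b c d a' b' c' d' :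
  a * d - b * c != 0 -> a' * d' - b' * c' != 0 ->
  mob a b c d \o mob a' b' c' d' =
  mob (a * a' + b * c') (a * b' + b * d') (c * a' + d * c') (c * b' + d * d').
Proof.
move=> D D'; apply/funext => z; have [u [v [h ->]]] := ptP z.
rewrite /= !mob_pt ?lin_nz2 //; first by congr pt; ring.
have -> : (a * a' + b * c') * (c * b' + d * d') -
  (a * b' + b * d') * (c * a' + d * c') = (a * d - b * c) * (a' * d' - b' * c') by ring.
exact: mulf_neq0.
Qed.

Lemma mobius_comp (phi psi : sphere R -> sphere R) :
  mobius phi -> mobius psi -> mobius (phi \o psi).
Proof.
move=> [a [b [c [d [D ->]]]]] [a' [b' [c' [d' [D' ->]]]]].
exists (a * a' + b * c'), (a * b' + b * d'), (c * a' + d * c'), (c * b' + d * d').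
split; last exact: mob_comp.
have -> : (a * a' + b * c') * (c * b' + d * d') -
  (a * b' + b * d') * (c * a' + d * c') = (a * d - b * c) * (a' * d' - b' * c') by ring.
exact: mulf_neq0.
Qed.

Lemma mobius_id : mobius (@id (sphere R)).
Proof.
exists 1, 0, 0, 1; rewrite mulr0 subr0 mulr1 oner_neq0.
by split=> //; rewrite -[RHS]/(mob 1 0 0 1) mob_scalar ?oner_neq0.
Qed.

Lemma mobius_inv (phi : sphere R -> sphere R) : mobius phi ->
  exists psi, [/\ mobius psi, cancel phi psi & cancel psi phi].
Proof.
(* The adjugate matrix; its product with the given matrix is the determinant times the identity,
   which acts trivially on the sphere. *)
move=> [a [b [c [d [D ->]]]]]; exists (mob d (- b) (- c) a).
have D' : d * a - - b * - c != 0 by rewrite mulrNN mulrC.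
split; first by exists d, (- b), (- c), a.
  move=> z; rewrite -[LHS]/((mob d (- b) (- c) a \o mob a b c d) z) mob_comp //.
  rewrite (_ : d * b + _ = 0); last by ring.
  rewrite (_ : - c * a + _ = 0); last by ring.
  rewrite (_ : d * a + _ = - c * b + a * d); last by ring.
  by rewrite mob_scalar // addrC mulNr [c * b]mulrC.
move=> z; rewrite -[LHS]/((mob a b c d \o mob d (- b) (- c) a) z) mob_comp //.
rewrite (_ : a * - b + _ = 0); last by ring.
rewrite (_ : c * d + _ = 0); last by ring.
rewrite (_ : c * - b + _ = a * d + b * - c); last by ring.
by rewrite mob_scalar // mulrN.
Qed.

(** In a conjugacy only [phi] is assumed to be Möbius; uniqueness of the inverse gives the same for
    [psi]. *)
Lemma mobius_cancel (phi psi : sphere R -> sphere R) : mobius phi ->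
  cancel phi psi -> cancel psi phi -> mobius psi.
Proof.
move=> /mobius_inv [psi' [m k1 k2]] k k'; suff -> : psi = psi' by [].
by apply/funext => z; rewrite -{1}[z]k2 k.
Qed.

Lemma nondeg_post n a b c d p q : a * d - b * c != 0 -> nondeg n p q ->
  nondeg n (a *: p + b *: q) (c *: p + d *: q).
Proof.
move=> D [sp sq h]; split=> [||u v /h huv].
- by rewrite (leq_trans (size_polyD _ _)) // geq_max !(leq_trans (size_scale_leq _ _)).
- by rewrite (leq_trans (size_polyD _ _)) // geq_max !(leq_trans (size_scale_leq _ _)).
- by rewrite !bform_lin lin_nz2.
Qed.

Lemma mob_ratfun n a b c d p q : a * d - b * c != 0 -> nondeg n p q ->
  mob a b c d \o ratfun p q = ratfun (a *: p + b *: q) (c *: p + d *: q).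
Proof.
move=> D h; apply/funext => z; have [u [v [huv ->]]] := ptP z.
rewrite /= (ratfun_pt h) // (ratfun_pt (nondeg_post D h)) // !bform_lin mob_pt //.
by case: h => _ _; apply.
Qed.

(** Substitution of (a u + b v, c u + d v) into the form of degree n belonging to p, expressed on
    dehomogenized polynomials. *)
Definition hsub n p a b c d : {poly C} :=
  \sum_(i < n.+1) p`_i *: (lin a b ^+ i * lin c d ^+ (n - i)).

Lemma size_expr_lin (k : nat) a b : (size (lin a b ^+ k)%R <= k.+1)%N.
Proof.
elim: k => [|k IH]; first by rewrite expr0 size_poly1.
by rewrite exprS; exact: (@size_poly_mul_le _ 1 k _ _ (size_lin a b) IH).
Qed.

Lemma bform_expr_lin (k : nat) a b u v : bform k (lin a b ^+ k) u v = (a * u + b * v) ^+ k.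
Proof.
elim: k => [|k IH].
  by rewrite !expr0 /bform big_ord1 coefC eqxx !expr0 !mul1r.
by rewrite !exprS -[k.+1]/(1 + k)%N bform_mul ?size_lin ?size_expr_lin // IH bform_lin1.
Qed.

Lemma size_hsub n p a b c d : (size (hsub n p a b c d) <= n.+1)%N.
Proof.
apply: (leq_trans (size_sum _ _ _)); apply/bigmax_leqP => i _.
apply: (leq_trans (size_scale_leq _ _)).
apply: leq_trans (size_poly_mul_le (size_expr_lin i a b) (size_expr_lin (n - i) c d)) _.
by rewrite subnKC // -ltnS.
Qed.

Lemma bform_hsub n p a b c d u v :
  bform n (hsub n p a b c d) u v = bform n p (a * u + b * v) (c * u + d * v).
Proof.
rewrite /hsub; transitivity (\sum_(i < n.+1) p`_i * bform n (lin a b ^+ i * lin c d ^+ (n - i)) u v).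
  elim: index_enum => [|i s IH].
    rewrite !big_nil /bform big1 // => i _; by rewrite coef0 mul0r.
  by rewrite !big_cons -[X in _ + X]scale1r bform_lin mul1r IH.
apply: eq_bigr => i _; congr (_ * _).
have := bform_mul u v (size_expr_lin i a b) (size_expr_lin (n - i) c d).
by rewrite subnKC ?bform_expr_lin // -ltnS.
Qed.

Lemma nondeg_pre n a b c d p q : a * d - b * c != 0 -> nondeg n p q ->
  nondeg n (hsub n p a b c d) (hsub n q a b c d).
Proof.
move=> D [sp sq h]; split; rewrite ?size_hsub // => u v huv.
by rewrite !bform_hsub h // lin_nz2.
Qed.

Lemma ratfun_mob n a b c d p q : a * d - b * c != 0 -> nondeg n p q ->
  ratfun p q \o mob a b c d = ratfun (hsub n p a b c d) (hsub n q a b c d).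
Proof.
move=> D h; apply/funext => z; have [u [v [huv ->]]] := ptP z.
rewrite [RHS](ratfun_pt (nondeg_pre D h)) // !bform_hsub /= mob_pt //.
by rewrite (ratfun_pt h) ?lin_nz2.
Qed.

Lemma rational_conj n (f phi psi : sphere R -> sphere R) : (0 < n)%N ->
  mobius phi -> mobius psi -> rational_map n f -> rational_map n (phi \o f \o psi).
Proof.
move=> n0 [a [b [c [d [D ->]]]]] [a' [b' [c' [d' [D' ->]]]]].
move=> /(rational_nondeg _ n0) [p [q [h ->]]]; apply/rational_nondeg => //.
rewrite -/(lin _ _) -/(lin _ _) -/(mob _ _ _ _) -/(lin a' b') -/(lin c' d') -/(mob a' b' c' d').
rewrite (mob_ratfun D h) (ratfun_mob D' (nondeg_post D h)).
by do 2 eexists; split; [apply: nondeg_pre D' (nondeg_post D h)|].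
Qed.

End HomogeneousCoordinates.

(** * Critical points *)

Lemma horner_lin (F : nzRingType) (a b t : F) : (a *: 'X + b%:P).[t] = a * t + b.
Proof. by rewrite hornerD hornerZ hornerX hornerC. Qed.

Lemma horner_lin_shift (F : comNzRingType) (a b w t : F) :
  (a *: 'X + (a * w + b)%:P).[t] = a * (w + t) + b * 1.
Proof. by rewrite horner_lin; ring. Qed.

(** Multiplicativity of the determinant; it shows that post-composition with a Möbius map multiplies
    the Wronskian by a nonzero constant. *)
Lemma det_comb (F : comPzRingType) (a b c d x x' y y' : F) :
  (a * x' + b * y') * (c * x + d * y) - (a * x + b * y) * (c * x' + d * y') =
  (a * d - b * c) * (x' * y - x * y').
Proof. by ring. Qed.

Section PolynomialDerivatives.
Variable K : numFieldType.
Implicit Types (w : K) (p q : {poly K}).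

Lemma is_derive_horner p w : is_derive w (1 : K) (horner p) p^`().[w].
Proof.
elim/poly_ind: p => [|p c IH].
  have -> : horner (0 : {poly K}) = cst 0 by apply/funext => y; rewrite horner0.
  by rewrite deriv0 horner0; exact: is_derive_cst.
have -> : horner (p * 'X + c%:P) = (horner p * id + cst c)%R.
  by apply/funext => y; rewrite !hornerE.
apply: is_derive_eq; rewrite derivD derivM derivX derivC mulr1 !addr0 hornerD hornerMX /=.
by rewrite ?(scaler0, addr0) -[_%:A]/(p.[w] * 1) -[w *: _]/(w * _) mulr1 addrC mulrC.
Qed.

Lemma is_derive_frac p q : q.[0] != 0 ->
  is_derive (0 : K) (1 : K) (fun t => p.[t] / q.[t])
    ((p^`().[0] * q.[0] - p.[0] * q^`().[0]) / q.[0] ^+ 2).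
Proof.
move=> q0; have dp := is_derive_horner p 0; have dq := is_derive_horner q 0.
have [dq1 dq2] := dq.
have dV : is_derive (0 : K) (1 : K) (fun t => (q.[t])^-1) (- q.[0] ^- 2 * q^`().[0]).
  by split; [exact: derivableV|rewrite deriveV // dq2].
apply: (is_derive_eq (is_deriveM dp dV)).
rewrite -[_ *: (- _ * _)]/(p.[0] * _) -[_ *: p^`().[0]]/(_ * p^`().[0]).
by field.
Qed.

Lemma near_horner_neq0 p : p.[0] != 0 -> \forall t \near (0 : K), p.[t] != 0.
Proof.
move=> p0; have : {for (0 : K), continuous (horner p)}.
  apply/differentiable_continuous/derivable1_diffP.
  by have [] := is_derive_horner p 0.
by move=> /cvgr_neq0; apply.
Qed.

(** The chain rule for a vanishing outer derivative, so that the value of the inner derivative never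
    has to be computed. *)
Lemma is_derive_comp0 (g h : K -> K) x : derivable h x 1 ->
  is_derive (h x) (1 : K) g 0 -> is_derive x (1 : K) (g \o h) 0.
Proof.
move=> /derivable1_diffP dh [/derivable1_diffP dg eg].
have dc := differentiable_comp dh dg.
split; first exact/derivable1_diffP.
rewrite deriveE // diff_comp //=.
have -> : 'd g (h x) ('d h x 1) = 'd h x 1 *: 'd g (h x) (1 : K).
  by rewrite -linearZ /= -[_ *: 1]/(_ * 1) mulr1.
have e0 : 'd g (h x) (1 : K) = 0 by rewrite -[RHS]eg; exact/esym/deriveE.
by rewrite e0 scaler0.
Qed.

End PolynomialDerivatives.

(** * Critical points as zeros of a Wronskian, and their behaviour under Möbius maps *)

Section CriticalPoints.
Variable R : realType.
Local Notation C := (Cplx R).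
Implicit Types (a b c d u v k w : C) (p q P Q : {poly C}) (z : sphere R).

Lemma chart_aff a u v : v != 0 -> chart (Some a : sphere R) (pt u v) = (u - a * v) / v.
Proof. by move=> v0; rewrite /pt (negbTE v0) /= mulrBl mulfK. Qed.

Lemma chart_inf u v : chart (infty R) (pt u v) = v / u.
Proof.
by rewrite /pt; case: eqP => [->|_] /=; rewrite ?mul0r // invf_div.
Qed.

Lemma param0 z : param z 0 = z.
Proof. by case: z => [a|] /=; rewrite ?addr0 ?eqxx. Qed.

Lemma param_inf t : param (infty R) t = pt 1 t.
Proof. by rewrite /= /pt div1r. Qed.

(** In the chart centred at its value at t = 0, the point [P : Q] reads Q / P if that value is
    infinity and (P - a Q) / Q if it is a finite a. In both cases the numerator of the derivative at
    0 is the Wronskian of P and Q up to sign. For a finite centre the condition on t excludes the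
    parameters sent to infinity, where [chart] takes a default value. *)
Lemma chart_pt_frac P Q : nz2 P.[0] Q.[0] ->
  exists p q, [/\ q.[0] != 0,
    (forall t, Q.[t] != 0 \/ P.[0] != 0 /\ Q.[0] = 0 ->
       chart (pt P.[0] Q.[0]) (pt P.[t] Q.[t]) = p.[t] / q.[t]) &
    p^`().[0] * q.[0] - p.[0] * q^`().[0] = 0 <->
    P^`().[0] * Q.[0] - P.[0] * Q^`().[0] = 0].
Proof.
move=> h; case: (eqVneq Q.[0] 0) => Q0.
  have P0 : P.[0] != 0 by move: h; rewrite /nz2 Q0 eqxx orbF.
  exists Q, P; split => // [t _|].
    by rewrite {1}/pt Q0 eqxx chart_inf.
  have -> : P^`().[0] * Q.[0] - P.[0] * Q^`().[0] =
    - (Q^`().[0] * P.[0] - Q.[0] * P^`().[0]) by ring.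
  by split => [->|/eqP]; rewrite ?oppr0 // oppr_eq0 => /eqP.
exists (P - (P.[0] / Q.[0]) *: Q), Q; split => // [t [Qt|[_ /eqP]]|].
- by rewrite {1}/pt (negbTE Q0) chart_aff // !hornerE.
- by rewrite (negbTE Q0).
have -> : (P - (P.[0] / Q.[0]) *: Q)^`().[0] * Q.[0] -
   (P - (P.[0] / Q.[0]) *: Q).[0] * Q^`().[0] =
   P^`().[0] * Q.[0] - P.[0] * Q^`().[0].
  by rewrite derivB derivZ !hornerE; field.
by [].
Qed.

Lemma critical_frac P Q (f : sphere R -> sphere R) z :
  (forall t, f (param z t) = pt P.[t] Q.[t]) -> nz2 P.[0] Q.[0] ->
  critical_point f z <-> P^`().[0] * Q.[0] - P.[0] * Q^`().[0] = 0.
Proof.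
move=> fE h; have [p [q [q0 E <-]]] := chart_pt_frac h.
have fz : f z = pt P.[0] Q.[0] by rewrite -fE param0.
have D := is_derive_frac p q0.
have nE : \forall t \near (0 : C), p.[t] / q.[t] = (chart (f z) \o f \o param z) t.
  case: (eqVneq Q.[0] 0) => [Q0|/near_horner_neq0].
    near=> t; rewrite /= fz fE E //; right; split=> //.
    by move: h; rewrite /nz2 Q0 eqxx orbF.
  by apply: filterS => t Qt /=; rewrite fz fE E //; left.
rewrite /critical_point; split=> [cr|e].
  have := @near_eq_is_derive _ _ _ _ _ _ _ _ nE D => -[_ e1]; case: cr => _ e2.
  move: e1; rewrite e2 => /esym/eqP; rewrite mulf_eq0 invr_eq0 expf_eq0 /= (negbTE q0) orbF.
  by move/eqP.
apply: (near_eq_is_derive nE); move: D; rewrite e mul0r; exact.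
Unshelve. all: by end_near. Qed.

(** The Wronskian in the local coordinate of [param]: in the coordinate 1/z at infinity, p has value
    p_n and derivative p_(n-1) at 0. *)
Definition jac n p q z : C := match z with
  | Some w => p^`().[w] * q.[w] - p.[w] * q^`().[w]
  | None => p`_n.-1 * q`_n - p`_n * q`_n.-1 end.

Lemma critical_jac n p q z : (0 < n)%N -> nondeg n p q ->
  critical_point (ratfun p q) z <-> jac n p q z = 0.
Proof.
move=> n0 h; case: z => [w|].
  have hE (r : {poly C}) t : (r \Po ('X + w%:P)).[t] = r.[w + t].
    by rewrite horner_comp !hornerE addrC.
  have dE (r : {poly C}) : (r \Po ('X + w%:P))^`().[0] = r^`().[w].
    by rewrite deriv_comp derivD derivX derivC addr0 mulr1 horner_comp hornerD hornerX hornerC add0r.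
  have := @critical_frac (p \Po ('X + w%:P)) (q \Po ('X + w%:P)) (ratfun p q) (Some w).
  rewrite !dE !hE addr0; apply; last exact: nondeg_horner h.
  by move=> t; rewrite !hE.
have [sp sq _] := h.
(* Reversal with respect to n, not to the actual degree of r: this is the form of degree n read in
   the coordinate 1/z. *)
pose rv (r : {poly C}) := \poly_(i < n.+1) r`_(n - i).
have hE (r : {poly C}) t : (rv r).[t] = bform n r 1 t.
  rewrite /rv /bform horner_poly (reindex_inj rev_ord_inj) /=; apply: eq_bigr => i _.
  by rewrite subSS subKn ?expr1n ?mul1r // -ltnS.
have r0 (r : {poly C}) : (rv r).[0] = r`_n.
  by rewrite horner_coef0 coef_poly /= subn0.
have r1 (r : {poly C}) : (rv r)^`().[0] = r`_n.-1.
  by rewrite horner_coef0 coef_deriv coef_poly ltnS n0 subn1 mulr1n.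
have := @critical_frac (rv p) (rv q) (ratfun p q) None.
rewrite !r0 !r1; apply; last exact: nondeg_top h.
move=> t; rewrite param_inf (ratfun_pt h); last by rewrite /nz2 oner_neq0.
by rewrite !hE.
Qed.

Lemma critical_post n (f phi : sphere R -> sphere R) z : (0 < n)%N ->
  mobius phi -> rational_map n f ->
  critical_point (phi \o f) z <-> critical_point f z.
Proof.
move=> n0 [a [b [c [d [D ->]]]]] /(rational_nondeg _ n0) [p [q [h ->]]].
rewrite -/(lin a b) -/(lin c d) -/(mob a b c d) (mob_ratfun D h).
rewrite (critical_jac _ n0 (nondeg_post D h)) (critical_jac _ n0 h).
have -> : jac n (a *: p + b *: q) (c *: p + d *: q) z =
    (a * d - b * c) * jac n p q z.
  case: z => [w|]; rewrite /jac; last by rewrite !coefD !coefZ; apply: det_comb.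
  by rewrite !derivD !derivZ !hornerD !hornerZ; apply: det_comb.
by split => [/eqP|->]; rewrite ?mulr0 // mulf_eq0 (negbTE D) => /eqP.
Qed.

(** Near t = 0 the moving point stays in the affine piece around the centre, on which [chart] and
    [param] are mutually inverse. *)
Lemma param_chart_pt P Q : nz2 P.[0] Q.[0] ->
  \forall t \near (0 : C),
    param (pt P.[0] Q.[0]) (chart (pt P.[0] Q.[0]) (pt P.[t] Q.[t])) = pt P.[t] Q.[t].
Proof.
move=> h; case: (eqVneq Q.[0] 0) => Q0.
  have P0 : P.[0] != 0 by move: h; rewrite /nz2 Q0 eqxx orbF.
  apply: filterS (near_horner_neq0 P0) => t Pt.
  rewrite Q0 {1 2}/pt eqxx chart_inf param_inf -[RHS](pt_scale _ _ (invr_neq0 Pt)).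
  by rewrite mulVf // mulrC.
apply: filterS (near_horner_neq0 Q0) => t Qt.
rewrite {1 2}/pt (negbTE Q0) chart_aff //= {1}/pt (negbTE Qt).
by congr Some; field; rewrite Qt.
Qed.

(** The local expression of f \o phi at z is, near 0, that of f at phi z after that of phi. An
    implication for arbitrary f is enough: the converse follows by applying it to the inverse Möbius
    map. *)
Lemma critical_pre (f phi : sphere R -> sphere R) z : mobius phi ->
  critical_point f (phi z) -> critical_point (f \o phi) z.
Proof.
move=> [a [b [c [d [D ->]]]]].
rewrite -/(lin a b) -/(lin c d) -/(mob a b c d) => cr.
have [P [Q [PQ h]]] : exists P Q, (forall t, mob a b c d (param z t) = pt P.[t] Q.[t]) /\
    nz2 P.[0] Q.[0].
  case: z {cr} => [w|].
    exists (lin a (a * w + b)), (lin c (c * w + d)).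
    have E a' b' t : (lin a' (a' * w + b')).[t] = a' * (w + t) + b' * 1.
      exact: horner_lin_shift.
    have h t : nz2 (w + t) 1 by rewrite /nz2 oner_neq0 orbT.
    split=> [t|]; last by rewrite !E; exact: lin_nz2.
    by rewrite !E -mob_pt // /pt oner_eq0 divr1.
  exists (lin b a), (lin d c).
  have E a' b' t : (lin b' a').[t] = a' * 1 + b' * t.
    by rewrite [LHS]horner_lin mulr1 addrC.
  have h t : nz2 1 t by rewrite /nz2 oner_neq0.
  split=> [t|]; last by rewrite !E; exact: lin_nz2.
  by rewrite !E -mob_pt // param_inf.
have Az : mob a b c d z = pt P.[0] Q.[0] by rewrite -PQ param0.
have [p [q [q0 E _]]] := chart_pt_frac h.
pose B (t : C) := p.[t] / q.[t].
have nE : \forall t \near (0 : C), chart (pt P.[0] Q.[0]) (pt P.[t] Q.[t]) = B t.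
  case: (eqVneq Q.[0] 0) => [Q0|/near_horner_neq0].
    near=> t; rewrite E //; right; split=> //.
    by move: h; rewrite /nz2 Q0 eqxx orbF.
  by apply: filterS => t Qt; rewrite E //; left.
have B0 : B 0 = 0.
  rewrite -(nbhs_singleton nE) /pt; case: eqP => //= _; exact: subrr.
move: cr; rewrite /critical_point Az; set g := chart _ \o f \o param _ => cr.
have dgB : is_derive (0 : C) (1 : C) (g \o B) 0.
  apply: is_derive_comp0; last by rewrite B0.
  by have [] := is_derive_frac p q0.
apply: near_eq_is_derive dgB; apply: filterS2 nE (param_chart_pt h) => t e1 e2.
by rewrite /g /comp PQ Az -[in RHS]e2 e1.
Unshelve. all: end_near. Qed.

End CriticalPoints.

(** * Marked conjugacy classes *)

Section MarkedClasses.
Variable R : realType.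
Variable n : nat.
Hypothesis n0 : (0 < n)%N.
Local Notation C := (Cplx R).
Implicit Types (f g phi psi : sphere R -> sphere R) (z : sphere R) (t : triple R).

Lemma critical_conj f phi psi z : mobius phi -> cancel phi psi -> cancel psi phi ->
  rational_map n f ->
  critical_point (phi \o f \o psi) (phi z) <-> critical_point f z.
Proof.
move=> m k k' rf; have m' := mobius_cancel m k k'.
have rf' : rational_map n (f \o psi) by apply: rational_conj n0 (mobius_id R) m' rf.
rewrite -[phi \o f \o psi]/(phi \o (f \o psi)) (critical_post _ n0 m rf').
split=> cr; last by apply: critical_pre => //; rewrite k.
have -> : f = (f \o psi) \o phi by apply/funext => x /=; rewrite k.
exact: critical_pre.
Qed.

Lemma marked_class_refl t : marked_class t t.
Proof. by case: t => [[f c1] c2]; exists id, id; split => //; exact: mobius_id. Qed.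

Lemma marked_class_sym t t' : marked_class t t' -> marked_class t' t.
Proof.
case: t => [[f c1] c2] [phi [psi [m k k' ->]]]; exists psi, phi.
split => //; first exact: mobius_cancel m k k'.
by rewrite !k; congr (_, _, _); apply/funext => x /=; rewrite !k.
Qed.

Lemma marked_class_trans t1 t2 t3 :
  marked_class t1 t2 -> marked_class t2 t3 -> marked_class t1 t3.
Proof.
case: t1 => [[f c1] c2] [phi [psi [m k k' ->]]] [phi' [psi' [m' l l' ->]]].
exists (phi' \o phi), (psi \o psi'); split => //; first exact: mobius_comp.
- by move=> x /=; rewrite l k.
- by move=> x /=; rewrite k' l'.
Qed.

Lemma marked_class_eq t t' : marked_class t t' -> marked_class t = marked_class t'.
Proof.
move=> h; apply/seteqP; split=> x hx; last exact: marked_class_trans h hx.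
exact: marked_class_trans (marked_class_sym h) hx.
Qed.

Lemma marked_bicritical_conj t t' :
  marked_bicritical n t -> marked_class t t' -> marked_bicritical n t'.
Proof.
case: t => [[f c1] c2] [rf c12 cr] [phi [psi [m k k' ->]]]; split.
- exact: rational_conj n0 m (mobius_cancel m k k') rf.
- by move=> /(can_inj k).
- move=> z; rewrite -[z]k' critical_conj // cr k'.
  by split=> -[h|h]; [left|right|left|right]; rewrite ?h ?k // -h k'.
Qed.

Lemma swap_markingK : involutive (@swap_marking R).
Proof. by case=> [[f c1] c2]. Qed.

Lemma marked_class_swap t t' :
  marked_class t t' -> marked_class (swap_marking t) (swap_marking t').
Proof. by case: t => [[f c1] c2] [phi [psi [m k k' ->]]]; exists phi, psi. Qed.

Lemma swap_marked_class t :
  @swap_marking R @` marked_class t = marked_class (swap_marking t).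
Proof.
apply/seteqP; split=> [_ [t' h <-]|t' h]; first exact: marked_class_swap.
by exists (swap_marking t'); rewrite ?swap_markingK // -[t]swap_markingK; apply: marked_class_swap.
Qed.

Lemma marked_bicritical_swap t :
  marked_bicritical n t -> marked_bicritical n (swap_marking t).
Proof.
case: t => [[f c1] c2] [rf c12 cr]; split => // [|z]; first exact: nesym.
by rewrite cr; split=> -[->|->]; [right|left|right|left].
Qed.

Lemma swap_marked_moduli (K : set (triple R)) :
  marked_moduli n K -> marked_moduli n (@swap_marking R @` K).
Proof.
case=> t h <-; exists (swap_marking t); first exact: marked_bicritical_swap.
by rewrite swap_marked_class.
Qed.

Lemma marking_orbit_inj (K K' : set (triple R)) : marking_orbit K = marking_orbit K' ->
  K' = K \/ K' = @swap_marking R @` K.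
Proof.
move=> e; have : marking_orbit K' K' by left.
by rewrite -e => -[->|->]; [left|right].
Qed.

Lemma underlying_orbit f (c1 c2 : sphere R) :
  underlying (marking_orbit (marked_class (f, c1, c2))) = hol_class f.
Proof.
apply/seteqP; split=> [g [K [d1 [d2 [[->|->]]]]]|g [phi [psi [m k k' ->]]]].
- by move=> [phi [psi [m k k' [-> _ _]]]]; exists phi, psi.
- rewrite swap_marked_class => -[phi [psi [m k k' [-> _ _]]]].
  by exists phi, psi.
- exists (marked_class (f, c1, c2)), (phi c1), (phi c2); split; first by left.
  by exists phi, psi.
Qed.

Lemma hol_class_refl f : hol_class f f.
Proof. by exists id, id; split => //; exact: mobius_id. Qed.

(** Injectivity holds because a conjugacy between the underlying maps carries the two critical
    points of one onto those of the other, hence either respects the numbering or reverses it; the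
    orbit contains both markings. *)
Theorem underlying_bij : set_bij (@moduli R n) (@hol_classes R n) (@underlying R).
Proof.
split.
- move=> _ [_ [[[f c1] c2] [rf c12 cr] <-] <-]; rewrite underlying_orbit.
  by exists f => //; split => //; exists c1, c2.
- move=> m m'; rewrite !inE => -[_ [[[f c1] c2] h <-] <-] [_ [[[g d1] d2] h' <-] <-].
  rewrite !underlying_orbit => e.
  have [phi [psi [m1 k k' eg]]] : hol_class f g by rewrite e; exact: hol_class_refl.
  have hg : marked_class (f, c1, c2) (g, phi c1, phi c2).
    by exists phi, psi; rewrite eg.
  have [_ d12 crg'] := h'.
  have [_ phi12 crg] := marked_bicritical_conj h hg.
  have [e1|e1] : d1 = phi c1 \/ d1 = phi c2 by apply/crg/crg'; left.
    have [e2|e2] : d2 = phi c1 \/ d2 = phi c2 by apply/crg/crg'; right.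
      by case: d12; rewrite e1 e2.
    by rewrite e1 e2 (marked_class_eq hg).
  have [e2|e2] : d2 = phi c1 \/ d2 = phi c2 by apply/crg/crg'; right.
    rewrite e1 e2 (marked_class_eq hg) /marking_orbit !swap_marked_class.
    by rewrite setUC.
  by case: d12; rewrite e1 e2.
- move=> _ [f [rf [c1 [c2 [c12 cr]]]] <-].
  exists (marking_orbit (marked_class (f, c1, c2))); last exact: underlying_orbit.
  by exists (marked_class (f, c1, c2)) => //; exists (f, c1, c2).
Qed.

End MarkedClasses.

(** * Rational maps critical only at 0 and infinity *)

Section WronskianMonomial.
Variable F : numClosedFieldType.
Implicit Types (p q W : {poly F}).

(** Once the power of X is split off, the cofactor has no root at all, so it is constant over an
    algebraically closed field. *)
Lemma monomial_of_roots W : (forall w, w != 0 -> W.[w] != 0) ->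
  exists k m, k != 0 /\ W = k *: 'X^m.
Proof.
move=> h; have W0 : W != 0.
  by apply: contraNneq (h _ (oner_neq0 F)) => ->; rewrite horner0.
have [m [r]] := multiplicity_XsubC W 0.
rewrite W0 subr0 /= => r0 We.
have /size_poly1P [k k0 rk] : size r == 1.
  apply/negPn/negP => /closed_rootP [w rw].
  have w0 : w != 0 by apply: contraNneq r0 => <-.
  by have := h _ w0; rewrite We hornerM (eqP rw) mul0r eqxx.
by exists k, m; split => //; rewrite We rk mul_polyC.
Qed.

(* Compare the lowest terms of X (u'y - uy') for u = r X^j. *)
Lemma wronskian_order (r y : {poly F}) (k : F) m j :
  y.[0] != 0 -> r.[0] != 0 -> (0 < j)%N ->
  (r * 'X^j)^`() * y - (r * 'X^j) * y^`() = k *: 'X^m -> j = m.+1.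
Proof.
move=> y0 r0 j0 We.
have : 'X * ((r * 'X^j)^`() * y - (r * 'X^j) * y^`()) =
   (j%:R *: (r * y) + (r^`() * y - r * y^`()) * 'X) * 'X^j.
  case: j j0 {We} => // j _; rewrite derivM derivXn -scaler_nat exprS /=.
  by rewrite -!mul_polyC; ring.
rewrite We -scalerAr -exprS => /(congr1 (fun p : {poly F} => p`_j)).
rewrite coefZ coefXn coefMXn ltnn subnn coefD coefZ coefMX /= addr0 -!horner_coef0 hornerM.
case: eqP => // _ /eqP; rewrite mulr0 eq_sym !mulf_eq0 pnatr_eq0.
by rewrite (negbTE r0) (negbTE y0) -leqn0 leqNgt j0.
Qed.

(* Compare the top terms of X (s'y - sy'). *)
Lemma wronskian_degree (s y : {poly F}) (k : F) m n : (size y <= n.+1)%N -> y`_n != 0 ->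
  (0 < size s <= n)%N -> s^`() * y - s * y^`() = k *: 'X^m -> (m.+1 = (size s).-1 + n)%N.
Proof.
move=> sy yn /andP [s0 sn] We.
pose d := (size s).-1; have ds : size s = d.+1 by rewrite prednK.
have sX (r : {poly F}) l : (size r <= l.+1)%N -> (size ('X * r^`())%R <= l.+1)%N.
  move=> sr; rewrite mulrC (leq_trans (size_polyMleq _ _)) // size_polyX addn2 /=.
  case: (eqVneq r 0) => [->|r0]; first by rewrite deriv0 size_poly0.
  by rewrite (leq_trans (lt_size_deriv r0)).
have cX (r : {poly F}) l : ('X * r^`())`_l = r`_l *+ l.
  by rewrite mulrC coefMX; case: l => [|l]; rewrite ?mulr0n // coef_deriv.
have : ('X * s^`()) * y - s * ('X * y^`()) = k *: 'X^(m.+1) :> {poly F}.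
  by rewrite exprS [RHS]scalerAr -We; ring.
move=> /(congr1 (fun p : {poly F} => p`_(d + n))).
rewrite coefB !coef_top_mul ?sX ?ds // !cX coefZ coefXn.
case: eqP => [<-|_ /eqP]; first by rewrite addnC.
(* The top terms could cancel only for d = n, which the bound on the size of s excludes. *)
have -> : s`_d *+ d * y`_n - s`_d * (y`_n *+ n) = s`_d * y`_n * (d%:R - n%:R).
  by rewrite mulrBr !mulr_natr mulrnAl mulrnAr.
rewrite mulr0.
rewrite !mulf_eq0 (negbTE yn) -[s`_d]/(lead_coef s) lead_coef_eq0 -size_poly_eq0.
by rewrite ds /= subr_eq0 eqr_nat => /eqP dn; move: sn; rewrite ds dn ltnn.
Qed.

(** Let u = q(0) p - p(0) q have order j at 0 and let s = q_n p - p_n q have degree d. The two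
    comparisons give j = m + 1 = d + n, while j <= n because u has degree at most n. Hence d = 0 and
    j = n: s is constant and u is a multiple of X^n. *)
Lemma bicritical_monomial n p q : (0 < n)%N ->
  (size p <= n.+1)%N -> (size q <= n.+1)%N ->
  (p.[0] != 0) || (q.[0] != 0) -> (p`_n != 0) || (q`_n != 0) ->
  (forall w, w != 0 -> (p^`() * q - p * q^`()).[w] != 0) ->
  p`_n * q`_0 - p`_0 * q`_n != 0 /\
  p = p`_n *: 'X^n + (p`_0)%:P /\ q = q`_n *: 'X^n + (q`_0)%:P.
Proof.
move=> n0 sp sq pq0 pqn /monomial_of_roots [k [m [k0 We]]].
have W0 : p^`() * q - p * q^`() != 0.
  by rewrite We scaler_eq0 negb_or k0 -size_poly_eq0 size_polyXn.
have nX (c : F) : c != 0 -> (c * k) *: 'X^m != 0 :> {poly F}.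
  by move=> c0; rewrite scaler_eq0 !negb_or mulf_neq0 // -size_poly_eq0 size_polyXn.
have comb (a b : F) : (a *: p - b *: q)^`() * p - (a *: p - b *: q) * p^`() =
      b *: (p^`() * q - p * q^`()) /\
    (a *: p - b *: q)^`() * q - (a *: p - b *: q) * q^`() =
      a *: (p^`() * q - p * q^`()).
  by rewrite derivB !derivZ -!mul_polyC; split; ring.
pose u : {poly F} := q.[0] *: p - p.[0] *: q; pose s : {poly F} := q`_n *: p - p`_n *: q.
(* The partner y is p or q, whichever is nonzero at 0; the Wronskian of u and y is then y(0) times
   that of p and q, so it is still a nonzero monomial of degree m. *)
have [y [y0 uy]] : exists y : {poly F}, y.[0] != 0 /\
    u^`() * y - u * y^`() = (y.[0] * k) *: 'X^m.
  by case/orP: pq0 => h; [exists p|exists q]; split => //;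
    rewrite -scalerA -We; [case: (comb q.[0] p.[0])|case: (comb q.[0] p.[0])].
have [z [zn [sz suz]]] : exists z : {poly F}, z`_n != 0 /\ (size z <= n.+1)%N /\
    s^`() * z - s * z^`() = (z`_n * k) *: 'X^m.
  by case/orP: pqn => h; [exists p|exists q]; do !split => //;
    rewrite -scalerA -We; [case: (comb q`_n p`_n)|case: (comb q`_n p`_n)].
have u0 : u != 0.
  by apply: contraNneq (nX _ y0) => e; rewrite -uy e deriv0 !mul0r subr0.
have s0 : s != 0.
  by apply: contraNneq (nX _ zn) => e; rewrite -suz e deriv0 !mul0r subr0.
have size_comb (a b : F) : (size (a *: p - b *: q)%R <= n.+1)%N.
  rewrite (leq_trans (size_polyD _ _)) // geq_max size_polyN.
  by rewrite !(leq_trans (size_scale_leq _ _)).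
have ss : (0 < size s <= n)%N.
  rewrite size_poly_gt0 s0 /= -ltnS ltn_neqAle size_comb andbT.
  apply: contraNneq s0 => e; rewrite -lead_coef_eq0 /lead_coef e /=.
  by rewrite coefB !coefZ mulrC subrr.
have [j [r]] := multiplicity_XsubC u 0; rewrite u0 subr0 /= => r0 ue.
have j0 : (0 < j)%N.
  case: j ue => // ue; have : u.[0] = 0 by rewrite /u !hornerE mulrC subrr.
  by rewrite ue expr0 mulr1 => /eqP; rewrite -[_ == 0]/(root r 0) (negbTE r0).
have jm : j = m.+1 by apply: (wronskian_order y0 r0 j0); rewrite -ue; exact: uy.
have sm := wronskian_degree sz zn ss suz.
have r_gt0 : (0 < size r)%N.
  by rewrite size_poly_gt0; apply: contraNneq r0 => ->; rewrite root0.
have su : (size r + j <= n.+1)%N.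
  have := size_comb q.[0] p.[0]; rewrite -/u ue size_mul ?size_polyXn.
  - by rewrite addnS.
  - by rewrite -size_poly_gt0.
  - by rewrite -size_poly_eq0 size_polyXn.
have je : j = ((size s).-1 + n)%N by rewrite jm sm.
have d0 : (size s).-1 = 0%N.
  have : (size r + (size s).-1 <= 1)%N by rewrite -(leq_add2r n) -addnA -je add1n.
  case: (size r) r_gt0 => // l _.
  by rewrite addSn ltnS leqn0 addn_eq0 => /andP [_ /eqP].
have s1 : size s = 1%N by have /andP [h _] := ss; rewrite -(prednK h) d0.
have jn : j = n by rewrite je d0.
have D : s`_0 != 0 by rewrite -[s`_0]/(s`_(1.-1)) -s1 -/(lead_coef s) lead_coef_eq0.
have D' : q`_n * p`_0 - p`_n * q`_0 != 0 by move: D; rewrite coefB !coefZ.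
(* Neither u nor s has a coefficient strictly between 0 and n. This is a linear system for the
   coefficients of p and q whose determinant is, up to sign, the nonzero constant term of s. *)
have mid i : (0 < i)%N -> (i < n)%N -> p`_i = 0 /\ q`_i = 0.
  move=> i0 iltn.
  have e1 : q`_n * p`_i - p`_n * q`_i = 0.
    by rewrite -!coefZ -coefB nth_default // -/s s1.
  have e2 : q`_0 * p`_i - p`_0 * q`_i = 0.
    by rewrite -!coefZ -coefB -!horner_coef0 -/u ue jn coefMXn iltn.
  split; apply: (mulfI D'); rewrite mulr0.
    have -> : (q`_n * p`_0 - p`_n * q`_0) * p`_i =
      p`_0 * (q`_n * p`_i - p`_n * q`_i) - p`_n * (q`_0 * p`_i - p`_0 * q`_i) by ring.
    by rewrite e1 e2 !mulr0 subr0.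
  have -> : (q`_n * p`_0 - p`_n * q`_0) * q`_i =
      q`_0 * (q`_n * p`_i - p`_n * q`_i) - q`_n * (q`_0 * p`_i - p`_0 * q`_i) by ring.
  by rewrite e1 e2 !mulr0 subr0.
split; first by rewrite -oppr_eq0 opprB [p`_0 * _]mulrC.
have shape (t : {poly F}) : (size t <= n.+1)%N ->
    (forall i, (0 < i)%N -> (i < n)%N -> t`_i = 0) -> t = t`_n *: 'X^n + (t`_0)%:P.
  move=> st ti; apply/polyP => i; rewrite coefD coefZ coefXn coefC.
  case: (ltngtP i n) => [lin|lin|->].
  - by case: i lin => [|i] lin; rewrite ?mulr0 ?add0r // ti // addr0.
  - by rewrite nth_default ?(leq_trans st) // mulr0 add0r; case: i lin.
  - by rewrite mulr1 -[n == _]negbK -lt0n n0 addr0.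
by split; apply: shape => // i i0 lin; case: (mid i i0 lin).
Qed.

End WronskianMonomial.

(** * The invariants and the scaling group *)

Section Invariants.
Variable F : fieldType.
Implicit Types (a b c d l m : F).

Definition invX a b c d : F := b * c / (a * d - b * c).
Definition invY1 n a b c d : F :=
  a ^+ n.+1 * b ^+ n.-1 / (a * d - b * c) ^+ n.
Definition invY2 n a b c d : F :=
  c ^+ n.-1 * d ^+ n.+1 / (a * d - b * c) ^+ n.

Lemma det_scale n a b c d l m :
  m * l * a * (m * l ^+ n * d) - m * (l * l ^+ n) * b * (m * c) =
  m ^+ 2 * (l * l ^+ n) * (a * d - b * c).
Proof. by ring. Qed.

(** The change of coefficients caused by conjugation with z -> l z, together with a common factor m
    of numerator and denominator. *)
Definition scale_invariant n (e : F -> F -> F -> F -> F) := forall a b c d l m,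
  a * d - b * c != 0 -> l != 0 -> m != 0 ->
  e (m * l * a) (m * (l * l ^+ n) * b) (m * c) (m * l ^+ n * d) = e a b c d.

Lemma invX_scale n : scale_invariant n invX.
Proof.
move=> a b c d l m D l0 m0; rewrite /invX det_scale.
by field; rewrite ?(mulf_eq0, expf_eq0, andbF, (negbTE D), (negbTE m0), (negbTE l0)).
Qed.

Lemma invY1_scale n : (0 < n)%N -> scale_invariant n (invY1 n).
Proof.
case: n => // n _ a b c d l m D l0 m0; rewrite /invY1 det_scale !exprMn.
move: (a * d - b * c) D => e e0; rewrite /= !exprS ?expr0.
by field; rewrite ?(mulf_eq0, expf_eq0, andbF, (negbTE e0), (negbTE m0), (negbTE l0)).
Qed.

Lemma invY2_scale n : (0 < n)%N -> scale_invariant n (invY2 n).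
Proof.
case: n => // n _ a b c d l m D l0 m0; rewrite /invY2 det_scale !exprMn.
move: (a * d - b * c) D => e e0; rewrite /= !exprS ?expr0.
by field; rewrite ?(mulf_eq0, expf_eq0, andbF, (negbTE e0), (negbTE m0), (negbTE l0)).
Qed.

(** Since X + 1 = a d / (a d - b c), both sides equal (a d)^(n+1) (b c)^(n-1) / (a d - b c)^(2n). *)
Lemma inv_relation n a b c d : (0 < n)%N -> a * d - b * c != 0 ->
  invY1 n a b c d * invY2 n a b c d =
  invX a b c d ^+ n.-1 * (invX a b c d + 1) ^+ n.+1.
Proof.
case: n => // n _ D; have -> : invX a b c d + 1 = a * d / (a * d - b * c).
  by rewrite /invX; field.
rewrite /invY1 /invY2 /invX !exprMn !exprVn.
move: (a * d - b * c) D => e e0; rewrite /= !exprS.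
by field; rewrite ?(mulf_eq0, expf_eq0, andbF, (negbTE e0)).
Qed.

(** Reversing the coefficients is conjugation by z -> 1/z, which interchanges infinity and 0. *)
Lemma inv_swap n a b c d : a * d - b * c != 0 ->
  [/\ d * a - c * b != 0, invX d c b a = invX a b c d,
      invY1 n d c b a = invY2 n a b c d & invY2 n d c b a = invY1 n a b c d].
Proof.
move=> D; have e : d * a - c * b = a * d - b * c by ring.
by rewrite /invX /invY1 /invY2 e D; split => //; congr (_ / _); rewrite mulrC.
Qed.

End Invariants.

(** * Completeness and range of the invariants modulo scaling *)

Section ScalingClasses.
Variable F : numClosedFieldType.
Implicit Types (a b c d l m x y : F).

Definition scale_equiv n a b c d a' b' c' d' := exists l m, [/\ l != 0, m != 0 &
  [/\ a' = m * l * a, b' = m * (l * l ^+ n) * b, c' = m * c & d' = m * l ^+ n * d]].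

(** The target has b = 1 and determinant 1. It depends only on X and the chosen root r of Y1, so two
    quadruples with the same X and Y1 reach the same target. *)
Lemma scale_canonical n a b c d r : (1 < n)%N -> a * d - b * c != 0 -> r != 0 ->
  r ^+ n.+1 = invY1 n a b c d ->
  scale_equiv n a b c d r 1 (invX a b c d) ((invX a b c d + 1) / r).
Proof.
case: n => [|[|n]] // _ D r0 rE.
have [a0 b0] : a != 0 /\ b != 0.
  have : invY1 n.+2 a b c d != 0 by rewrite -rE expf_neq0.
  rewrite /invY1 mulf_eq0 negb_or mulf_eq0 negb_or => /andP [/andP [ha hb] _].
  by split; [apply: contraNneq ha => ->|apply: contraNneq hb => ->]; rewrite expr0n.
have -> : invX a b c d + 1 = a * d / (a * d - b * c) by rewrite /invX; field.
rewrite /invX; move: rE; rewrite /invY1 /=; move: (a * d - b * c) D => e e0 rE.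
(* Reading m c = X as m = b / e, the equation m l a = r gives this l; then m l^(n+1) b = 1 amounts
   to the hypothesis on r. *)
pose l := r * e / (a * b).
have l0 : l != 0 by rewrite !mulf_neq0 ?invr_neq0 ?mulf_neq0.
have ll : l * l ^+ n.+2 = e / b ^+ 2.
  rewrite -exprS /l !exprMn rE exprVn exprMn !exprS ?expr0.
  by field; rewrite ?(mulf_eq0, expf_eq0, andbF, (negbTE a0), (negbTE b0), (negbTE e0)).
have lE : l ^+ n.+2 = e / b ^+ 2 / l by rewrite -ll; field.
exists l, (b / e); split=> //; first by rewrite mulf_neq0 ?invr_neq0.
split; rewrite ?ll ?lE /l; field; rewrite ?r0 ?a0 ?b0 ?e0 //.
Qed.

Lemma scale_equiv_sym n a b c d a' b' c' d' :
  scale_equiv n a b c d a' b' c' d' -> scale_equiv n a' b' c' d' a b c d.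
Proof.
move=> [l [m [l0 m0 [-> -> -> ->]]]]; exists l^-1, m^-1; rewrite !invr_eq0 exprVn.
by split => //; split; field; rewrite ?(mulf_eq0, expf_eq0, andbF, (negbTE m0), (negbTE l0)).
Qed.

Lemma scale_equiv_trans n a b c d a' b' c' d' a'' b'' c'' d'' :
  scale_equiv n a b c d a' b' c' d' -> scale_equiv n a' b' c' d' a'' b'' c'' d'' ->
  scale_equiv n a b c d a'' b'' c'' d''.
Proof.
move=> [l [m [l0 m0 [-> -> -> ->]]]] [l' [m' [l0' m0' [-> -> -> ->]]]].
exists (l' * l), (m' * m); rewrite !mulf_neq0 // exprMn.
by split => //; split; ring.
Qed.

(* The canonical form requires Y1 != 0; if only Y2 != 0, it becomes available after
   interchanging the critical points. *)
Lemma inv_equiv n a b c d a' b' c' d' : (1 < n)%N ->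
  a * d - b * c != 0 -> a' * d' - b' * c' != 0 ->
  invX a b c d = invX a' b' c' d' ->
  invY1 n a b c d = invY1 n a' b' c' d' ->
  invY2 n a b c d = invY2 n a' b' c' d' ->
  scale_equiv n a b c d a' b' c' d' \/ scale_equiv n d c b a d' c' b' a'.
Proof.
move=> n1 D D' eX eY1 eY2; have n0 : (0 < n)%N := ltnW n1.
have [Y1|Y1] := eqVneq (invY1 n a b c d) 0; last first.
  left; pose r := n.+1.-root (invY1 n a b c d).
  have rE : r ^+ n.+1 = invY1 n a b c d by rewrite rootCK.
  have r0 : r != 0 by rewrite rootC_eq0.
  apply: (scale_equiv_trans (scale_canonical n1 D r0 rE)).
  by rewrite eX; apply/scale_equiv_sym/scale_canonical => //; rewrite rE.
have [Y2|Y2] := eqVneq (invY2 n a b c d) 0; last first.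
  right; pose r := n.+1.-root (invY2 n a b c d).
  have rE : r ^+ n.+1 = invY2 n a b c d by rewrite rootCK.
  have r0 : r != 0 by rewrite rootC_eq0.
  have [D1 X1 Y11 _] := inv_swap n D; have [D2 X2 Y12 _] := inv_swap n D'.
  apply: (@scale_equiv_trans _ _ _ _ _ _ _ _ _ _ _ _ _ (scale_canonical n1 D1 r0 _)).
    by rewrite rE.
  rewrite X1 eX -X2; apply/scale_equiv_sym/scale_canonical => //.
  by rewrite rE Y12.
left.
(* If Y1 and Y2 both vanish, only the monomial maps with exponent -n or n remain, and X tells them
   apart. *)
have zero (u v w z : F) : u * z - v * w != 0 -> invY1 n u v w z = 0 -> invY2 n u v w z = 0 ->
    (u = 0 /\ z = 0 /\ invX u v w z = -1) \/ (v = 0 /\ w = 0 /\ invX u v w z = 0).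
  move=> E; rewrite /invY1 /invY2 => /eqP.
  rewrite mulf_eq0 invr_eq0 mulf_eq0 !expf_eq0 /= (negbTE E) andbF orbF.
  move=> h1 /eqP; rewrite mulf_eq0 invr_eq0 mulf_eq0 !expf_eq0 /= (negbTE E) andbF orbF.
  rewrite -!subn1 !subn_gt0 n1 /= in h1 *.
  case/orP: h1 E => /eqP -> E /orP [] /eqP e; move: E; rewrite e.
  - by rewrite mul0r mulr0 subr0 eqxx.
  - move=> E; left; split=> //; split=> //; move: E.
    by rewrite /invX mul0r sub0r oppr_eq0 => E; rewrite invrN mulrN divff.
  - move=> E; right; split => //; split=> //.
    by rewrite /invX mul0r mul0r.
  - by rewrite mulr0 mul0r subr0 eqxx.
have [[a0 [d0 X]]|[b0 [c0 X]]] := zero _ _ _ _ D Y1 Y2;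
  have [[a0' [d0' X']]|[b0' [c0' X']]] := zero _ _ _ _ D' (etrans (esym eY1) Y1) (etrans (esym eY2) Y2).
- move: D D'; rewrite a0 d0 a0' d0' !mul0r !sub0r !oppr_eq0 !mulf_eq0 !negb_or.
  move=> /andP [b0 c0] /andP [b0' c0'].
  (* Scaling multiplies b / c by l^(n+1). *)
  pose l := n.+1.-root (b' * c / (b * c')).
  have lE : l * l ^+ n = b' * c / (b * c') by rewrite -exprS rootCK.
  exists l, (c' / c); split.
  + by rewrite rootC_eq0 // !mulf_neq0 ?invr_neq0 ?mulf_neq0.
  + by rewrite mulf_neq0 ?invr_neq0.
  + by rewrite lE !mulr0; split => //; field; rewrite ?b0 ?c0 ?c0'.
- by move/eqP: eX; rewrite X X' oppr_eq0 oner_eq0.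
- by move/eqP: eX; rewrite X X' eq_sym oppr_eq0 oner_eq0.
- move: D D'; rewrite b0 c0 b0' c0' !mul0r !subr0 !mulf_eq0 !negb_or.
  move=> /andP [a0 d0] /andP [a0' d0'].
  (* Scaling divides a / d by l^(n-1), and n - 1 > 0 makes the root available. *)
  pose l := n.-1.-root (a * d' / (a' * d)).
  have n1' : (0 < n.-1)%N by case: n n1 {n0 eY1 eY2 Y1 Y2 zero l} => [|[]].
  have l0 : l != 0 by rewrite rootC_eq0 // !mulf_neq0 ?invr_neq0 ?mulf_neq0.
  have lE : l ^+ n = l * (a * d' / (a' * d)) by rewrite -{1}(prednK n0) exprS rootCK.
  exists l, (a' / (l * a)); split => //.
  + by rewrite !mulf_neq0 ?invr_neq0 ?mulf_neq0.
  + by rewrite lE !mulr0; split => //; field; rewrite ?a0 ?d0 ?l0 ?a0'.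
Qed.

(** The form with b = 1 and determinant 1 is a preimage if y1 is nonzero, and its reversal covers
    nonzero y2. If both vanish, the relation forces x = 0 or x = -1, realized by z^n and -z^(-n). *)
Lemma inv_surj n x y1 y2 : (1 < n)%N -> y1 * y2 = x ^+ n.-1 * (x + 1) ^+ n.+1 ->
  exists a b c d, [/\ a * d - b * c != 0, invX a b c d = x,
    invY1 n a b c d = y1 & invY2 n a b c d = y2].
Proof.
move=> n1.
have gen y y' : y != 0 -> y * y' = x ^+ n.-1 * (x + 1) ^+ n.+1 ->
    exists a b c d, [/\ a * d - b * c != 0, invX a b c d = x,
      invY1 n a b c d = y & invY2 n a b c d = y'].
  move=> y0 e; pose r := n.+1.-root y.
  have rE : r ^+ n.+1 = y by rewrite rootCK.
  have r0 : r != 0 by rewrite rootC_eq0.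
  exists r, 1, x, ((x + 1) / r).
  have D : r * ((x + 1) / r) - 1 * x = 1 by field.
  rewrite /invX /invY1 /invY2 D !expr1n !divr1 oner_neq0 mul1r mulr1 rE.
  by split => //; rewrite exprMn exprVn rE mulrA -e; field.
have [Y1|Y1] := eqVneq y1 0; last exact: gen.
have [Y2|Y2] := eqVneq y2 0; last first.
  rewrite mulrC => /(gen _ _ Y2) [a [b [c [d [D X Y3 Y4]]]]].
  by have [? ? ? ?] := inv_swap n D; exists d, c, b, a; split => //; congruence.
rewrite Y1 Y2 mul0r => /esym/eqP; rewrite mulf_eq0 !expf_eq0 /= addr_eq0 => h.
have np : (n.-1 == 0)%N = false by case: n n1 {gen h} => [|[]].
case/orP: h => [/andP [_ /eqP ->]|/eqP ->].
  exists 1, 0, 0, 1; rewrite /invX /invY1 /invY2 !mulr0 subr0 mulr1 mul0r oner_neq0.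
  by rewrite !expr0n np !mulr0 !mul0r.
exists 0, 1, (-1), 0; rewrite /invX /invY1 /invY2 !mul0r !mul1r sub0r opprK oner_neq0.
by rewrite !expr0n /= ?mulr0 !mul0r ?divr1.
Qed.

End ScalingClasses.

(** * Normal forms *)

Section Binomial.
Variable F : fieldType.
Implicit Types (a b w : F).

Lemma size_binomial n a b : (size (a *: 'X^n + b%:P)%R <= n.+1)%N.
Proof.
rewrite (leq_trans (size_polyD _ _)) // geq_max (leq_trans (size_scale_leq _ _)) ?size_polyXn //.
by rewrite (leq_trans (size_polyC_leq1 _)).
Qed.

Lemma horner_binomial n a b w : (a *: 'X^n + b%:P).[w] = a * w ^+ n + b.
Proof. by rewrite hornerD hornerZ hornerXn hornerC. Qed.

Lemma top_binomial n a b : (0 < n)%N -> (a *: 'X^n + b%:P)`_n = a.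
Proof. by case: n => // n _; rewrite coefD coefZ coefXn coefC eqxx mulr1 addr0. Qed.

Lemma mid_binomial n a b : (1 < n)%N -> (a *: 'X^n + b%:P)`_n.-1 = 0.
Proof.
case: n => [|[|n]] // _; rewrite coefD coefZ coefXn coefC /= addr0.
by rewrite ltn_eqF ?mulr0.
Qed.

Lemma deriv_binomial n a b w : (a *: 'X^n + b%:P)^`().[w] = a * (w ^+ n.-1 *+ n).
Proof. by rewrite derivD derivZ derivXn derivC addr0 hornerZ hornerMn hornerXn. Qed.

Lemma wronskian_binomial n a b c d w :
  a * (w ^+ n.-1 *+ n) * (c * w ^+ n + d) - (a * w ^+ n + b) * (c * (w ^+ n.-1 *+ n)) =
  (a * d - b * c) * w ^+ n.-1 * n%:R.
Proof. by rewrite -[in LHS](mulr_natr (w ^+ n.-1)); ring. Qed.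

Lemma binomial_homog n a b u v : v != 0 -> v ^+ n * (a * (u / v) ^+ n + b) = a * u ^+ n + b * v ^+ n.
Proof. by move=> v0; rewrite exprMn exprVn; field; rewrite expf_eq0 (negbTE v0) andbF. Qed.

End Binomial.

Section NormalForms.
Variable R : realType.
Variable n : nat.
Hypothesis n1 : (1 < n)%N.
Local Notation C := (Cplx R).
Implicit Types (a b c d u v k w l m : C) (z : sphere R).
Let n0 : (0 < n)%N := ltnW n1.

Lemma bform_binomial a b u v : bform n (a *: 'X^n + b%:P) u v = a * u ^+ n + b * v ^+ n.
Proof.
rewrite bformE ?size_binomial // horner_binomial top_binomial //.
case: eqP => [->|/eqP v0]; last exact: binomial_homog.
by rewrite expr0n eqn0Ngt n0 mulr0 addr0.
Qed.

Lemma nz2_expr u v : nz2 u v -> nz2 (u ^+ n) (v ^+ n).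
Proof. by rewrite /nz2 !expf_eq0 n0. Qed.

Lemma nondeg_normal a b c d : a * d - b * c != 0 ->
  nondeg n (a *: 'X^n + b%:P) (c *: 'X^n + d%:P).
Proof.
move=> D; split; rewrite ?size_binomial // => u v h.
by rewrite !bform_binomial lin_nz2 // nz2_expr.
Qed.

Lemma normal_pt a b c d u v : a * d - b * c != 0 -> nz2 u v ->
  normal_form n a b c d (pt u v) =
  pt (a * u ^+ n + b * v ^+ n) (c * u ^+ n + d * v ^+ n).
Proof.
by move=> D h; rewrite /normal_form (ratfun_pt (nondeg_normal D)) // !bform_binomial.
Qed.

Lemma pt_inf u : pt u 0 = infty R. Proof. by rewrite /pt eqxx. Qed.

Lemma pt_origin v : v != 0 -> pt 0 v = origin R.
Proof. by move=> v0; rewrite /pt (negbTE v0) mul0r. Qed.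

(** The Wronskian is n (a d - b c) z^(n-1). At infinity the criterion involves the coefficients of
    degree n - 1, which vanish because 0 < n - 1 < n. *)
Lemma normal_bicritical a b c d : a * d - b * c != 0 ->
  marked_bicritical n (normal_form n a b c d, infty R, origin R).
Proof.
move=> D; have h := nondeg_normal D; split => //.
  by apply/rational_nondeg => //; do 2 eexists; split; [exact: h|].
move=> z; rewrite /normal_form (critical_jac _ n0 h) /jac.
case: z => [w|]; last first.
  split=> [_|_]; first by left.
  by rewrite !mid_binomial // mul0r mulr0 subrr.
rewrite !horner_binomial !deriv_binomial wronskian_binomial.
split=> [/eqP|[//|[->]]].
  rewrite !mulf_eq0 (negbTE D) pnatr_eq0 -[n == 0%N]negbK -lt0n n0 orbF /=.
  by rewrite expf_eq0 => /andP [_ /eqP ->]; right.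
rewrite expr0n; have -> : (n.-1 == 0)%N = false by case: n n1 => [|[]].
by rewrite mulr0 mul0r.
Qed.

Lemma exists_normal_map (f : sphere R -> sphere R) :
  marked_bicritical n (f, infty R, origin R) ->
  exists a b c d, a * d - b * c != 0 /\ f = normal_form n a b c d.
Proof.
case=> /(rational_nondeg _ n0) [p [q [h ->]]] _ cr.
have [sp sq _] := h.
have [|||D [ep eq]] := bicritical_monomial n0 sp sq.
- exact: nondeg_horner h.
- exact: nondeg_top h.
- move=> w w0; apply/eqP => e.
  have /cr : critical_point (ratfun p q) (Some w).
    apply/(critical_jac _ n0 h); rewrite -[RHS]e /jac.
    by rewrite hornerD hornerN !hornerM.
  by case=> // -[] /eqP; rewrite (negbTE w0).
exists p`_n, p`_0, q`_n, q`_0; split; first exact: D.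
by rewrite /normal_form -ep -eq.
Qed.

Lemma normal_scalar a b c d m : m != 0 -> a * d - b * c != 0 ->
  normal_form n (m * a) (m * b) (m * c) (m * d) = normal_form n a b c d.
Proof.
move=> m0 D; apply/funext => z; have [u [v [h ->]]] := ptP z.
rewrite (normal_pt D h) normal_pt //; last first.
  have -> : m * a * (m * d) - m * b * (m * c) = m * m * (a * d - b * c) by ring.
  by rewrite !mulf_neq0.
by rewrite -[RHS](pt_scale _ _ m0) !mulrDr !mulrA.
Qed.

Lemma scaling_inverse l : l != 0 ->
  [/\ mobius (mob l 0 0 1), cancel (mob l 0 0 1) (mob 1 0 0 l) &
      cancel (mob 1 0 0 l) (mob l 0 0 1)].
Proof.
move=> l0; have D1 : l * 1 - 0 * 0 != 0 by rewrite mul0r subr0 mulr1.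
have D2 : 1 * l - 0 * 0 != 0 by rewrite mul0r subr0 mul1r.
split; first by exists l, 0, 0, 1.
- move=> z; rewrite -[LHS]/((mob 1 0 0 l \o mob l 0 0 1) z) mob_comp //.
  by rewrite !(mul0r, mulr0, mul1r, mulr1, add0r, addr0) mob_scalar.
- move=> z; rewrite -[LHS]/((mob l 0 0 1 \o mob 1 0 0 l) z) mob_comp //.
  by rewrite !(mul0r, mulr0, mul1r, mulr1, add0r, addr0) mob_scalar.
Qed.

(** This is l f(z / l) after multiplying numerator and denominator by l^n. *)
Lemma normal_conj a b c d l : l != 0 -> a * d - b * c != 0 ->
  mob l 0 0 1 \o normal_form n a b c d \o mob 1 0 0 l =
  normal_form n (l * a) (l * l ^+ n * b) c (l ^+ n * d).
Proof.
move=> l0 D; have D1 : l * 1 - 0 * 0 != 0 by rewrite mul0r subr0 mulr1.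
have D2 : 1 * l - 0 * 0 != 0 by rewrite mul0r subr0 mul1r.
have D' : l * a * (l ^+ n * d) - l * l ^+ n * b * c != 0.
  have -> : l * a * (l ^+ n * d) - l * l ^+ n * b * c = l * l ^+ n * (a * d - b * c) by ring.
  by rewrite !mulf_neq0 ?expf_neq0.
apply/funext => z; have [u [v [h ->]]] := ptP z.
have h1 := lin_nz2 D2 h.
have h2 := lin_nz2 D (nz2_expr h1).
rewrite normal_pt // /comp (mob_pt D2 h) (normal_pt D h1) (mob_pt D1 h2).
by congr pt; rewrite !(mul0r, mulr0, mul1r, mulr1, add0r, addr0) exprMn; ring.
Qed.

Lemma mob_scale_inf l : l != 0 -> mob l 0 0 1 (infty R) = infty R.
Proof.
move=> l0; rewrite -[in LHS](pt_inf 1) mob_pt ?mul0r ?mulr0 ?addr0 ?pt_inf //.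
  by rewrite mulr1 subr0.
by rewrite /nz2 oner_neq0.
Qed.

Lemma mob_scale_origin l : l != 0 -> mob l 0 0 1 (origin R) = origin R.
Proof.
move=> l0; rewrite -[in LHS](pt_origin (oner_neq0 _)) mob_pt.
- by rewrite !mulr0 mul0r addr0 mulr1 add0r pt_origin ?oner_neq0.
- by rewrite mul0r mulr1 subr0.
- by rewrite /nz2 oner_neq0 orbT.
Qed.

Lemma normal_scale a b c d a' b' c' d' : a * d - b * c != 0 ->
  scale_equiv n a b c d a' b' c' d' ->
  marked_class (normal_form n a b c d, infty R, origin R)
               (normal_form n a' b' c' d', infty R, origin R).
Proof.
move=> D [l [m [l0 m0 [-> -> -> ->]]]]; have [ml k k'] := scaling_inverse l0.
exists (mob l 0 0 1), (mob 1 0 0 l); split => //.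
rewrite normal_conj // mob_scale_inf // mob_scale_origin //.
have D1 : l * a * (l ^+ n * d) - l * (l ^+ n * b) * c != 0.
  have -> : l * a * (l ^+ n * d) - l * (l ^+ n * b) * c = l * l ^+ n * (a * d - b * c) by ring.
  by rewrite !mulf_neq0 ?expf_neq0.
by congr (_, _, _); rewrite -!mulrA normal_scalar.
Qed.

Lemma normal_swap a b c d : a * d - b * c != 0 ->
  marked_class (normal_form n a b c d, origin R, infty R)
               (normal_form n d c b a, infty R, origin R).
Proof.
move=> D; have D1 : 0 * 0 - 1 * 1 != 0 :> C.
  by rewrite mul0r sub0r mul1r oppr_eq0 oner_neq0.
have D' : d * a - c * b != 0 by rewrite mulrC [c * b]mulrC.
have k : involutive (mob (0 : C) 1 1 0).
  move=> z; rewrite -[LHS]/((mob 0 1 1 0 \o mob 0 1 1 0) z) mob_comp //.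
  by rewrite !(mul0r, mulr0, mul1r, mulr1, add0r, addr0) mob_scalar ?oner_neq0.
exists (mob 0 1 1 0), (mob 0 1 1 0); split => //; first by exists 0, 1, 1, 0.
congr (_, _, _).
- apply/funext => z; have [u [v [h ->]]] := ptP z.
  have h1 := lin_nz2 D1 h.
  have h2 := lin_nz2 D (nz2_expr h1).
  rewrite normal_pt // /comp (mob_pt D1 h) (normal_pt D h1) (mob_pt D1 h2).
  by rewrite !(mul0r, mulr0, mul1r, mulr1, add0r, addr0) addrC [in RHS]addrC; congr pt; rewrite addrC.
- rewrite -[in RHS](pt_origin (oner_neq0 _)) mob_pt // ?{1}/nz2 ?oner_neq0 ?orbT //.
  by rewrite !(mul0r, mulr0, mulr1, add0r, addr0) pt_inf.
- rewrite -[in RHS](pt_inf 1) mob_pt ?{1}/nz2 ?oner_neq0 //.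
  by rewrite !(mul0r, mulr0, mulr1, add0r, addr0) pt_origin ?oner_neq0.
Qed.

(** Three points suffice: infinity and 0 give factors s and t for the columns (a, c) and (b, d), and
    the value at 1 forces s = t since the columns are independent. *)
Lemma normal_inj a b c d a' b' c' d' :
  a * d - b * c != 0 -> a' * d' - b' * c' != 0 ->
  normal_form n a b c d = normal_form n a' b' c' d' ->
  exists2 k, k != 0 & [/\ a' = k * a, b' = k * b, c' = k * c & d' = k * d].
Proof.
move=> D D' e.
have at_pt u v : nz2 u v -> exists2 k, k != 0 &
    a' * u ^+ n + b' * v ^+ n = k * (a * u ^+ n + b * v ^+ n) /\
    c' * u ^+ n + d' * v ^+ n = k * (c * u ^+ n + d * v ^+ n).
  move=> h; apply: pt_inj; rewrite ?lin_nz2 ?nz2_expr //.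
  by rewrite -!normal_pt // e.
have [|s s0] := at_pt 1 0; first by rewrite /nz2 oner_neq0.
have [|t t0] := at_pt 0 1; first by rewrite /nz2 oner_neq0 orbT.
have [|k k0] := at_pt 1 1; first by rewrite /nz2 oner_neq0.
rewrite !expr1n expr0n eqn0Ngt n0 !mulr0 !mulr1 !add0r !addr0.
move=> [e1 e2] [eb ed] [ea ec].
have st : (s - t) * (a * d - b * c) = 0.
  have -> : (s - t) * (a * d - b * c) =
    (s * a + t * b - k * (a + b)) * (d + c) - (s * c + t * d - k * (c + d)) * (a + b) by ring.
  by rewrite -ea -eb -ec -ed e1 e2; ring.
exists s => //.
have ts : t = s by apply/eqP; rewrite eq_sym -subr_eq0; move/eqP: st; rewrite mulf_eq0 (negbTE D) orbF.
by split=> //; rewrite -ts.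
Qed.

Lemma mobius_fix (phi : sphere R -> sphere R) : mobius phi ->
  phi (infty R) = infty R -> phi (origin R) = origin R ->
  exists2 l, l != 0 & phi = mob l 0 0 1.
Proof.
move=> [a [b [c [d [D ->]]]]]; rewrite -/(lin a b) -/(lin c d) -/(mob a b c d).
rewrite -{1}(pt_inf 1) -{1}(pt_origin (oner_neq0 _)) !mob_pt //; last 2 first.
- by rewrite /nz2 oner_neq0 orbT.
- by rewrite /nz2 oner_neq0.
rewrite !mulr0 !mulr1 !addr0 !add0r {1}/pt; case: eqP => // c0 _.
rewrite /pt; case: eqP => // /eqP d0 [] /eqP.
rewrite mulf_eq0 invr_eq0 (negbTE d0) orbF => /eqP b0.
move: D; rewrite b0 c0 mul0r subr0 mulf_eq0 negb_or => /andP [a0 _].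
exists (a / d); first by rewrite mulf_neq0 ?invr_neq0.
have D1 : a * d - 0 * 0 != 0 by rewrite mul0r subr0 mulf_neq0.
have D2 : a / d * 1 - 0 * 0 != 0 by rewrite mul0r subr0 mulr1 mulf_neq0 ?invr_neq0.
apply/funext => z; have [u [v [h ->]]] := ptP z; rewrite !mob_pt //.
by rewrite -[RHS](pt_scale _ _ d0); congr pt; [field|ring].
Qed.

Lemma normal_class_equiv a b c d a' b' c' d' :
  a * d - b * c != 0 -> a' * d' - b' * c' != 0 ->
  marked_class (normal_form n a b c d, infty R, origin R)
               (normal_form n a' b' c' d', infty R, origin R) ->
  scale_equiv n a b c d a' b' c' d'.
Proof.
move=> D D' [phi [psi [m k k' [e /esym e1 /esym e2]]]].
have [l l0 phiE] := mobius_fix m e1 e2.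
have [_ _ l'] := scaling_inverse l0.
have psiE : psi = mob 1 0 0 l.
  by apply/funext => z; apply: (can_inj k); rewrite k' phiE l'.
move: e; rewrite phiE psiE normal_conj // => e.
have D1 : l * a * (l ^+ n * d) - l * l ^+ n * b * c != 0.
  have -> : l * a * (l ^+ n * d) - l * l ^+ n * b * c = l * l ^+ n * (a * d - b * c) by ring.
  by rewrite !mulf_neq0 ?expf_neq0.
have [s s0 [-> -> -> ->]] := normal_inj D1 D' (esym e).
by exists l, s; split => //; rewrite !mulrA.
Qed.

Lemma pt_eq u v u' v' : nz2 u v -> nz2 u' v' -> v' * u - u' * v = 0 -> pt u v = pt u' v'.
Proof.
rewrite /pt => h h' /eqP; rewrite subr_eq0 => /eqP e.
case: (eqVneq v 0) => [v0|v0]; case: (eqVneq v' 0) => [v0'|v0'] //.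
- move: h e; rewrite /nz2 v0 eqxx orbF mulr0 => u0 /eqP.
  by rewrite mulf_eq0 (negbTE u0) (negbTE v0').
- move: h' e; rewrite /nz2 v0' eqxx orbF mul0r => u0 /esym/eqP.
  by rewrite mulf_eq0 (negbTE u0) (negbTE v0).
- by congr Some; apply/eqP; rewrite eqr_div // [u * v']mulrC e.
Qed.

Lemma exists_normal_form (t : triple R) : marked_bicritical n t ->
  exists a b c d, a * d - b * c != 0 /\
    marked_class t (normal_form n a b c d, infty R, origin R).
Proof.
case: t => [[f c1] c2] h; have [_ c12 _] := h.
have [u1 [v1 [h1 e1]]] := ptP c1; have [u2 [v2 [h2 e2]]] := ptP c2.
have D0 : v2 * u1 - u2 * v1 != 0.
  by apply/eqP => /(pt_eq h1 h2) e; case: c12; rewrite e1 e2.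
have D : v2 * - u1 - - u2 * v1 != 0.
  have -> : v2 * - u1 - - u2 * v1 = - (v2 * u1 - u2 * v1) by ring.
  by rewrite oppr_eq0.
(* The map [u : v] -> [v2 u - u2 v : v1 u - u1 v], with its pole at c1 and its zero at c2. *)
have m : mobius (mob v2 (- u2) v1 (- u1)) by do 4 eexists; split; first exact: D.
have [psi [m' k k']] := mobius_inv m.
have E1 : mob v2 (- u2) v1 (- u1) c1 = infty R.
  rewrite e1 mob_pt // (_ : v1 * u1 + _ = 0) ?pt_inf //; by ring.
have E2 : mob v2 (- u2) v1 (- u1) c2 = origin R.
  rewrite e2 mob_pt // (_ : v2 * u2 + _ = 0); last by ring.
  rewrite pt_origin // (_ : v1 * u2 + _ = - (v2 * u1 - u2 * v1)) ?oppr_eq0 //; by ring.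
have cl : marked_class (f, c1, c2)
    (mob v2 (- u2) v1 (- u1) \o f \o psi, infty R, origin R).
  by exists (mob v2 (- u2) v1 (- u1)), psi; rewrite E1 E2.
have [a [b [c [d [Dn fE]]]]] := exists_normal_map (marked_bicritical_conj n0 h cl).
by exists a, b, c, d; split => //; rewrite -fE.
Qed.

Definition normal_class a b c d : set (triple R) :=
  marked_class (normal_form n a b c d, infty R, origin R).

(** [normal_value] picks an arbitrary representative; two representatives with the same marking
    differ by a scaling, under which [e] is invariant. *)
Lemma normal_valueE (e : C -> C -> C -> C -> C) a b c d :
  scale_invariant n e -> a * d - b * c != 0 ->
  normal_value n e (normal_class a b c d) = e a b c d.
Proof.
move=> inv D; rewrite /normal_value; case: xgetP => [y _ [a' [b' [c' [d' [D' h ->]]]]]|].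
  have [l [m [l0 m0 [-> -> -> ->]]]] := normal_class_equiv D D' h.
  exact: inv.
move/(_ (e a b c d)) => /=; case; exists a, b, c, d; split => //; exact: marked_class_refl.
Qed.

Lemma coordE a b c d : a * d - b * c != 0 ->
  [/\ coordX n (normal_class a b c d) = invX a b c d,
      coordY1 n (normal_class a b c d) = invY1 n a b c d &
      coordY2 n (normal_class a b c d) = invY2 n a b c d].
Proof.
move=> D; split; apply: normal_valueE D; [exact: invX_scale|exact: invY1_scale|].
exact: invY2_scale.
Qed.

Lemma marked_moduliP (K : set (triple R)) : marked_moduli n K <->
  exists a b c d, a * d - b * c != 0 /\ K = normal_class a b c d.
Proof.
split=> [[t h <-]|[a [b [c [d [D ->]]]]]].
  have [a [b [c [d [D cl]]]]] := exists_normal_form h.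
  by exists a, b, c, d; split => //; exact: marked_class_eq.
by exists (normal_form n a b c d, infty R, origin R) => //; exact: normal_bicritical.
Qed.

Lemma swap_normal_class a b c d : a * d - b * c != 0 ->
  @swap_marking R @` normal_class a b c d = normal_class d c b a.
Proof.
by move=> D; rewrite swap_marked_class; apply/marked_class_eq/normal_swap.
Qed.

Lemma coord_swap (K : set (triple R)) : marked_moduli n K ->
  [/\ coordX n (@swap_marking R @` K) = coordX n K,
      coordY1 n (@swap_marking R @` K) = coordY2 n K &
      coordY2 n (@swap_marking R @` K) = coordY1 n K].
Proof.
move=> /marked_moduliP [a [b [c [d [D ->]]]]]; rewrite (swap_normal_class D).
have [D' e1 e2 e3] := inv_swap n D.
by have [-> -> ->] := coordE D; have [-> -> ->] := coordE D'; split.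
Qed.

Lemma coord_relation (K : set (triple R)) : marked_moduli n K ->
  coordY1 n K * coordY2 n K = coordX n K ^+ n.-1 * (coordX n K + 1) ^+ n.+1.
Proof.
move=> /marked_moduliP [a [b [c [d [D ->]]]]].
by have [-> -> ->] := coordE D; exact: inv_relation.
Qed.

Lemma coord_inj (K K' : set (triple R)) : marked_moduli n K -> marked_moduli n K' ->
  coordX n K = coordX n K' -> coordY1 n K = coordY1 n K' ->
  coordY2 n K = coordY2 n K' -> K = K'.
Proof.
move=> /marked_moduliP [a [b [c [d [D ->]]]]] /marked_moduliP [a' [b' [c' [d' [D' ->]]]]].
have [-> -> ->] := coordE D; have [-> -> ->] := coordE D' => e1 e2 e3.
have [s|s] := inv_equiv n1 D D' e1 e2 e3.
  exact/marked_class_eq/normal_scale.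
have [Ds _ _ _] := inv_swap n D.
have E : normal_class d c b a = normal_class d' c' b' a'.
  exact/marked_class_eq/normal_scale.
(* The swapped classes agree, and swapping is its own inverse on sets of triples. *)
have := swap_normal_class D; rewrite E -(swap_normal_class D') => /(congr1 (image^~ (@swap_marking R))).
by rewrite !image_comp (_ : @swap_marking R \o _ = id) ?image_id //; apply/funext/swap_markingK.
Qed.

Lemma coord_surj (x y1 y2 : C) : y1 * y2 = x ^+ n.-1 * (x + 1) ^+ n.+1 ->
  exists2 K, marked_moduli n K &
    [/\ coordX n K = x, coordY1 n K = y1 & coordY2 n K = y2].
Proof.
move=> /(inv_surj n1) [a [b [c [d [D e1 e2 e3]]]]].
exists (normal_class a b c d); first by apply/marked_moduliP; exists a, b, c, d.
by have [-> -> ->] := coordE D; split.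
Qed.

End NormalForms.

(** * Functions of the roots of a quadratic polynomial *)

Section Differentiability.
Variable K : numFieldType.
Implicit Types (V W : normedModType K).

Lemma differentiable_fst V W (x : V * W) : differentiable (fst : V * W -> V) x.
Proof. by apply: linear_differentiable => y; exact: cvg_fst. Qed.

Lemma differentiable_snd V W (x : V * W) : differentiable (snd : V * W -> W) x.
Proof. by apply: linear_differentiable => y; exact: cvg_snd. Qed.

Lemma differentiable_row V k (f : 'I_k -> V -> K) x :
  (forall i, differentiable (f i) x) ->
  differentiable (fun w => \row_i f i w) x.
Proof.
move=> df; have -> : (fun w => \row_i f i w) =
    \sum_i (fun w => f i w *: (delta_mx 0 i : 'rV[K]_k)).
  apply/funext => w; rewrite fct_sumE; apply/rowP => j; rewrite mxE summxE.
  rewrite (bigD1 j) //= !mxE !eqxx mulr1 big1 ?addr0 // => i ij.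
  by rewrite !mxE eq_sym (negbTE ij) andbF mulr0.
by apply: differentiable_sum => i; exact: differentiableZl.
Qed.

(** Serves to show that differentiability is local: two functions that agree near x differ by such
    an f. *)
Lemma near_eq0_differentiable V W (f : V -> W) x :
  (\forall y \near x, f y = 0) -> differentiable f x.
Proof.
move=> f0; have c0 : continuous (\0 : {linear V -> W}) by move=> y; exact: cst_continuous.
have E : f \o shift x = cst (f x) + (\0 : {linear V -> W}) +o_ 0 id.
  have fx := nbhs_singleton f0; apply/eqaddoP => _/posnumP[eps].
  move: f0; rewrite (near_shift 0 x) subr0; apply: filterS => y /= fy.
  rewrite -[X in `|X|]/(f (y + x) - (f x + 0)) fy addr0 fx.
  by rewrite subr0 normr0 mulr_ge0.
apply/diff_locallyP; rewrite (diff_unique c0 E); split; [exact: c0|exact: E].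
Qed.

Lemma near_eq_differentiable V W (f g : V -> W) x :
  (\forall y \near x, f y = g y) -> differentiable f x -> differentiable g x.
Proof.
move=> fg df; have -> : g = f + (g - f) by rewrite addrC subrK.
apply: differentiableD => //; apply: near_eq0_differentiable.
by apply: filterS fg => y e; rewrite -[LHS]/(g y - f y) e subrr.
Qed.

End Differentiability.

Section SymmetricFunctions.
Variable K : numFieldType.
Variable h : K -> K.
Hypothesis dh : forall x, differentiable h x.
Implicit Types (x y : K) (Q : K * K -> K).

(* A symmetric function of the roots of T^2 - s T + h x, as a function of (x, s). *)
Definition descends (P : K -> K -> K -> K) := exists Q : K * K -> K,
  (forall w, differentiable Q w) /\
  forall x y1 y2, y1 * y2 = h x -> P x y1 y2 = Q (x, y1 + y2).

Lemma descends_prod : descends (fun x y1 y2 => y1 * y2).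
Proof.
exists (h \o fst); split => // w; apply: differentiable_comp => //.
exact: differentiable_fst.
Qed.

Lemma descends_cst c : descends (fun _ _ _ => c).
Proof. by exists (cst c); split => // w; exact: differentiable_cst. Qed.

Lemma descendsM P P' : descends P -> descends P' ->
  descends (fun x y1 y2 => P x y1 y2 * P' x y1 y2).
Proof.
move=> [Q [dQ E]] [Q' [dQ' E']]; exists (Q * Q'); split=> [w|x y1 y2 e].
  exact: differentiableM.
by rewrite E // E'.
Qed.

Lemma descendsD P P' : descends P -> descends P' ->
  descends (fun x y1 y2 => P x y1 y2 + P' x y1 y2).
Proof.
move=> [Q [dQ E]] [Q' [dQ' E']]; exists (Q + Q'); split=> [w|x y1 y2 e].
  exact: differentiableD.
by rewrite E // E'.
Qed.

Lemma descendsX P k : descends P -> descends (fun x y1 y2 => P x y1 y2 ^+ k).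
Proof.
move=> dP; elim: k => [|k IH]; first exact: descends_cst.
have [Q [dQ E]] := descendsM dP IH.
by exists Q; split => // x y1 y2 e; rewrite exprS E.
Qed.

Lemma descends_x k : descends (fun x _ _ => x ^+ k).
Proof.
apply: (@descendsX (fun x _ _ => x)); exists fst; split => // w.
exact: differentiable_fst.
Qed.

Lemma descends_power_sum k : descends (fun x y1 y2 => y1 ^+ k + y2 ^+ k).
Proof.
(* Two consecutive exponents are carried along for Newton's recursion p_(k+2) = (y1 + y2) p_(k+1) -
   y1 y2 p_k. *)
suff : descends (fun x y1 y2 => y1 ^+ k + y2 ^+ k) /\
       descends (fun x y1 y2 => y1 ^+ k.+1 + y2 ^+ k.+1) by case.
have d1 : descends (fun x y1 y2 => y1 + y2).
  by exists snd; split => // w; exact: differentiable_snd.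
elim: k => [|k [IH IH']]; first by split => //; exact: (descends_cst (1 + 1)).
split => //.
have [Q [dQ E]] := descendsD (descendsM d1 IH')
  (descendsM (descends_cst (-1)) (descendsM descends_prod IH)).
exists Q; split => // x y1 y2 e; rewrite -E //.
by rewrite !exprS; ring.
Qed.

(** Pulling out the smaller power of y1 y2 leaves a power sum. *)
Lemma descends_monomial i j k :
  descends (fun x y1 y2 => x ^+ i * (y1 ^+ j * y2 ^+ k + y2 ^+ j * y1 ^+ k)).
Proof.
wlog jk : j k / (j <= k)%N.
  move=> wl; have [/wl //|/ltnW/wl [Q [dQ E]]] := leqP j k.
  by exists Q; split => // x y1 y2 e; rewrite -E //; ring.
have [Q [dQ E]] := descendsM (descends_x i)
  (descendsM (descendsX j descends_prod) (descends_power_sum (k - j))).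
exists Q; split => // x y1 y2 e; rewrite -E // -(subnKC jk).
by rewrite addKn !exprD exprMn; ring.
Qed.

(** P need not be symmetric as a polynomial, even if it induces an invariant function on the
    surface; hence the sum over both orders of the roots. *)
Lemma descends_meval (P : mpoly.mpoly 3 K) :
  descends (fun x y1 y2 => mpoly.meval (tnth [tuple x; y1; y2]) P +
                           mpoly.meval (tnth [tuple x; y2; y1]) P).
Proof.
pose ex (m : mpoly.multinom 3) := mpoly.fun_of_multinom m.
pose i1 : 'I_3 := lift ord0 ord0.
rewrite (_ : (fun _ _ _ => _) = fun x y1 y2 =>
  \sum_(m <- mpoly.msupp P) mpoly.mcoeff m P *
    (x ^+ ex m ord0 * (y1 ^+ ex m i1 * y2 ^+ ex m ord_max +
                       y2 ^+ ex m i1 * y1 ^+ ex m ord_max))).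
  elim: (X in descends (fun _ _ _ => \sum_(m <- X) _)) => [|m s [Q [dQ E]]].
    have [Q [dQ E]] := descends_cst 0.
    by exists Q; split=> // x y1 y2 e; rewrite big_nil; exact: E.
  have [Q' [dQ' E']] := descendsM (descends_cst (mpoly.mcoeff m P))
    (descends_monomial (ex m ord0) (ex m i1) (ex m ord_max)).
  exists (Q' + Q); split=> [w|x y1 y2 e]; first exact: differentiableD.
  by rewrite big_cons -[RHS]/(Q' _ + Q _) -E // -E'.
apply/funext => x; apply/funext => y1; apply/funext => y2.
rewrite !mpoly.mevalE -big_split /=; apply: eq_bigr => m _.
rewrite !big_ord_recl !big_ord0 /= !(tnth_nth 0) /=.
have -> : lift ord0 (lift ord0 ord0) = ord_max :> 'I_3 by apply: val_inj.
by rewrite !mulr1 -mulrDr -mulrDr.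
Qed.

End SymmetricFunctions.

(** * The quotient *)

Import (canonicals) mpoly.

Section RootsNear.
Variable K : numClosedFieldType.
Variable h : K -> K.
Hypothesis dh : forall x, differentiable h x.

(* The discriminant moves continuously, so one of its square roots stays close to
   y1 - y2; with the sum this determines a nearby pair of roots. *)
Lemma roots_near (O : set (K * K * K)) (x y1 y2 : K) :
  open O -> O (x, y1, y2) -> y1 * y2 = h x ->
  \forall w \near (x, y1 + y2),
    exists z1 z2, [/\ O (w.1, z1, z2), z1 + z2 = w.2 & z1 * z2 = h w.1].
Proof.
move=> oO Oxy exy.
(* [G] recovers x and the two roots from x, their sum and their difference; [D] is the discriminant,
   the square of that difference. *)
pose G (p : K * K * K) := (p.1.1, 2^-1 *: (p.1.2 + p.2), 2^-1 *: (p.1.2 - p.2)).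
pose D (w : K * K) := w.2 * w.2 - 4%:R *: h w.1.
have cG p : {for p, continuous G}.
  apply: differentiable_continuous.
  have d1 : differentiable (fun p : K * K * K => p.1.1) p.
    exact: (differentiable_comp (differentiable_fst _) (differentiable_fst _)).
  have d2 : differentiable (fun p : K * K * K => p.1.2) p.
    exact: (differentiable_comp (differentiable_fst _) (differentiable_snd _)).
  have d3 : differentiable (fun p : K * K * K => p.2) p by exact: differentiable_snd.
  apply: differentiable_pair; first apply: differentiable_pair => //.
    exact: (differentiableZ _ (differentiableD d2 d3)).
  exact: (differentiableZ _ (differentiableB d2 d3)).
have cD w : {for w, continuous D}.
  apply: differentiable_continuous.
  have d2 : differentiable (snd : K * K -> K) w by exact: differentiable_snd.
  have d1 : differentiable (h \o fst : K * K -> K) w.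
    exact: (differentiable_comp (differentiable_fst _) (dh _)).
  exact: (differentiableB (differentiableM d2 d2) (differentiableZ _ d1)).
pose w0 := (x, y1 + y2); pose s0 := y1 - y2.
have two : 2 != 0 :> K by rewrite pnatr_eq0.
have G0 : G (w0, s0) = (x, y1, y2).
  rewrite /G /w0 /s0 /=; congr (_, _, _).
    by rewrite -[LHS]/(2^-1 * (y1 + y2 + (y1 - y2))); field.
  by rewrite -[LHS]/(2^-1 * (y1 + y2 - (y1 - y2))); field.
have nO : nbhs (w0, s0) (G @^-1` O).
  by apply: cG; rewrite G0; exact: open_nbhs_nbhs.
case: nO => -[A B] /= [nA nB] AB.
have [e e0 sB] := (nbhs_ballP _ _).1 nB.
(* The bound is e * e because the change of the discriminant factors as (s0 - s)(s0 + s): one factor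
   is below e, which decides between the square roots s and -s. *)
have nD : \forall w \near w0, `|D w0 - D w| < e * e.
  by apply: cvgr_dist_lt (cD w0) _ _; rewrite mulr_gt0.
apply: filterS2 nA nD => w Aw Dw.
have D0 : D w0 = s0 * s0.
  by rewrite /D /w0 /s0 -[_ *: _]/(4%:R * h x) -exy /=; ring.
pose s := sqrtC (D w); have sE : s * s = D w by rewrite -expr2 sqrtCK.
have [t tE tB] : exists2 t, t * t = D w & `|s0 - t| < e.
  have : `|s0 - s| * `|s0 + s| < e * e.
    by rewrite -normrM (_ : _ * _ = D w0 - D w) // D0 -sE; ring.
  have [lt _|ge] := real_ltP (normr_real (s0 - s)) (gtr0_real e0); first by exists s.
  have [lt _|ge'] := real_ltP (normr_real (s0 + s)) (gtr0_real e0).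
    by exists (- s); rewrite ?mulrNN ?opprK.
  by move=> /(le_lt_trans (ler_pM (ltW e0) (ltW e0) ge ge')); rewrite ltxx.
have OG : O (G (w, t)).
  by apply: (AB (w, t)); split => //; apply: sB; rewrite -ball_normE.
exists (2^-1 * (w.2 + t)), (2^-1 * (w.2 - t)); split; first exact: OG.
  by field.
have -> : 2^-1 * (w.2 + t) * (2^-1 * (w.2 - t)) = 4%:R^-1 * (w.2 * w.2 - t * t).
  by field.
by rewrite tE /D -[_ *: _]/(4%:R * h w.1); field.
Qed.

End RootsNear.

(** * The coordinates (X, Y) as a biholomorphic map *)

Section Quotient.
Variable R : realType.
Variable n : nat.
Hypothesis n1 : (1 < n)%N.
Local Notation C := (Cplx R).
Let n0 : (0 < n)%N := ltnW n1.
Implicit Types (K : set (triple R)) (m : set (set (triple R))).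

Definition relation_poly (x : C) : C := x ^+ n.-1 * (x + 1) ^+ n.+1.

Lemma differentiable_relation_poly x : differentiable relation_poly x.
Proof.
have -> : relation_poly = horner ('X ^+ n.-1 * ('X + 1%:P) ^+ n.+1).
  by apply/funext => y; rewrite hornerM !horner_exp hornerD hornerX hornerC.
by apply/derivable1_diffP; have [] := is_derive_horner ('X ^+ n.-1 * ('X + 1%:P) ^+ n.+1) x.
Qed.

Definition quotient_coord m : C * C :=
  xget (0, 0) [set w | exists2 K, marked_moduli n K &
    m = marking_orbit K /\ w = (coordX n K, coordY1 n K + coordY2 n K)].

(** The orbit contains only K and its swap, and the swap merely exchanges the two summands. *)
Lemma quotient_coordE K : marked_moduli n K ->
  quotient_coord (marking_orbit K) = (coordX n K, coordY1 n K + coordY2 n K).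
Proof.
move=> hK; rewrite /quotient_coord; case: xgetP => [w _ [K' hK' [/marking_orbit_inj e ->]]|].
  by case: e => ->//; have [-> -> ->] := coord_swap n1 hK; rewrite addrC.
by move/(_ (coordX n K, coordY1 n K + coordY2 n K)); case; exists K.
Qed.

Lemma marking_orbit_swap K : marking_orbit (@swap_marking R @` K) = marking_orbit K.
Proof.
rewrite /marking_orbit image_comp (_ : @swap_marking R \o _ = id) ?image_id; last first.
  by apply/funext/swap_markingK.
by rewrite setUC.
Qed.

Lemma sum_prod_inj (F : idomainType) (a b a' b' : F) :
  a + b = a' + b' -> a * b = a' * b' -> (a = a' /\ b = b') \/ (a = b' /\ b = a').
Proof.
move=> s p; have bE : b = a' + b' - a by rewrite -s addrC addKr.
have : (a - a') * (a - b') = 0.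
  have -> : (a - a') * (a - b') = a * a - a * (a' + b') + a' * b' by ring.
  by rewrite -p -s; ring.
move/eqP; rewrite mulf_eq0 !subr_eq0 bE => /orP [] /eqP ->; [left|right]; split => //.
  by rewrite addrC addKr.
by rewrite addrK.
Qed.

Lemma quotient_coord_inj K K' : marked_moduli n K -> marked_moduli n K' ->
  quotient_coord (marking_orbit K) = quotient_coord (marking_orbit K') ->
  marking_orbit K = marking_orbit K'.
Proof.
move=> hK hK'; rewrite !quotient_coordE // => -[eX eY].
have eP : coordY1 n K * coordY2 n K = coordY1 n K' * coordY2 n K'.
  by rewrite !coord_relation // eX.
have [[e1 e2]|[e1 e2]] := sum_prod_inj eY eP.
  by rewrite (coord_inj n1 hK hK' eX e1 e2).
have [sX s1 s2] := coord_swap n1 hK'.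
rewrite -(marking_orbit_swap K'); congr marking_orbit.
apply: (coord_inj n1 hK (swap_marked_moduli hK')).
- by rewrite sX.
- by rewrite s1.
- by rewrite s2.
Qed.

Lemma quotient_coord_bij : set_bij (@moduli R n) setT quotient_coord.
Proof.
split => //.
  move=> m m'; rewrite !inE => -[K hK <-] [K' hK' <-]; exact: quotient_coord_inj.
(* The quadratic formula: (y + s) / 2 and (y - s) / 2 are the required Y1 and Y2. *)
move=> [x y] _; pose s := sqrtC (y * y - 4%:R * relation_poly x).
have [|K hK [eX e1 e2]] := @coord_surj R n n1 x (2^-1 * (y + s)) (2^-1 * (y - s)).
  have -> : 2^-1 * (y + s) * (2^-1 * (y - s)) = 4%:R^-1 * (y * y - s ^+ 2).
    by field.
  rewrite sqrtCK -[RHS]/(relation_poly x); move: (relation_poly x) => r.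
  by field.
exists (marking_orbit K); first by exists K.
by rewrite quotient_coordE // eX e1 e2; congr (_, _); field.
Qed.

Lemma quotient_open (U : set (set (set (triple R)))) : U `<=` @moduli R n ->
  moduli_open n U <-> open (quotient_coord @` U).
Proof.
move=> sU; split=> [[_ [S [oO E]]]|oW].
  rewrite openE => _ [m Um <-]; have [K hK mK] := sU _ Um.
  have : (marked_moduli n `&` @marking_orbit R @^-1` U) K by split => //=; rewrite mK.
  rewrite E => -[_ /= SK]; rewrite -mK quotient_coordE //.
  (* A point near (X, Y) has a pair of roots close to (Y1, Y2), hence comes from a marked class that
     still lies over U. *)
  have := roots_near differentiable_relation_poly oO SK (coord_relation n1 hK).
  apply: filterS => -[x y] [z1 [z2 [Oz /= sz pz]]].
  have [K' hK' [eX e1 e2]] := coord_surj n1 pz.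
  have : (marked_moduli n `&` [set K | S (coordX n K, coordY1 n K, coordY2 n K)]) K'.
    by split => //=; rewrite eX e1 e2.
  rewrite -E => -[_ /= UK']; exists (marking_orbit K') => //.
  by rewrite quotient_coordE // eX e1 e2 sz.
(* Conversely, the image is pulled back along (x, y1, y2) -> (x, y1 + y2) to an open set of the
   ambient space; injectivity on orbits shows that it cuts out exactly the classes over U. *)
split=> //; exists ((fun p : C * C * C => (p.1.1, p.1.2 + p.2)) @^-1` (quotient_coord @` U)).
split.
  apply: open_comp oW => p _; apply: differentiable_continuous.
  have d1 : differentiable (fun p : C * C * C => p.1.1) p.
    exact: (differentiable_comp (differentiable_fst _) (differentiable_fst _)).
  have d2 : differentiable (fun p : C * C * C => p.1.2) p.
    exact: (differentiable_comp (differentiable_fst _) (differentiable_snd _)).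
  have d3 : differentiable (fun p : C * C * C => p.2) p by exact: differentiable_snd.
  apply: differentiable_pair; first exact: d1.
  exact: (differentiableD d2 d3).
apply/seteqP; split=> K [hK /= h]; split => //=.
  by exists (marking_orbit K); rewrite ?quotient_coordE.
case: h => m Um; rewrite -quotient_coordE //; have [K' hK' mK'] := sU _ Um.
by move: Um; rewrite -mK' => Um /(quotient_coord_inj hK' hK) <-.
Qed.

Lemma regular_descends (r : set (set (triple R)) -> C) : moduli_regular n r ->
  exists Q : C * C -> C, (forall w, differentiable Q w) /\
    forall m, moduli n m -> r m = Q (quotient_coord m).
Proof.
move=> [P rP]; have [Q [dQ QE]] := descends_meval differentiable_relation_poly P.
(* The values of P at K and at its swap both equal r on the orbit, so the symmetrized polynomial
   gives twice r. *)
exists (2^-1 *: Q); split=> [w|_ [K hK <-]]; first exact: differentiableZ.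
rewrite quotient_coordE //.
have := QE _ _ _ (coord_relation n1 hK); rewrite -rP //.
have [sX s1 s2] := coord_swap n1 hK.
have := rP _ (swap_marked_moduli hK).
rewrite sX s1 s2 => <-; rewrite /comp marking_orbit_swap => e.
by rewrite -[RHS]/(2^-1 * Q _) -e; move: (r _) => z; field.
Qed.

Lemma coord_regular (i : 'I_2) : moduli_regular n
  (fun m => if i == ord0 then (quotient_coord m).1 else (quotient_coord m).2).
Proof.
pose X (j : 'I_3) : mpoly.mpoly 3 C := mpoly.mpolyX C (mpoly.mnm1 j).
exists (if i == ord0 then X ord0 else X (lift ord0 ord0) + X ord_max).
move=> K hK; rewrite /comp quotient_coordE //; case: eqP => _.
  by rewrite mpoly.mevalXU (tnth_nth 0).
by rewrite mpoly.mevalD !mpoly.mevalXU !(tnth_nth 0).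
Qed.

(** For the direct implication, the regular functions in a local presentation become differentiable
    functions of (X, Y), so that g agrees with a differentiable composite on the image of V, which
    is open. *)
Lemma quotient_holomorphic (U : set (set (set (triple R)))) (g : C * C -> C) :
  moduli_open n U ->
  moduli_holomorphic n U (g \o quotient_coord) <-> holomorphic2 (quotient_coord @` U) g.
Proof.
move=> oU; have sU := oU.1; split=> [hol _ [m Um <-]|hol m Um].
  have [V [k [r [S [H [[oV Vm VU] [reg oO dH E]]]]]]] := hol _ Um.
  have sV : V `<=` @moduli R n by move=> m' /VU /sU.
  have [Q HQ] := choice (fun i => regular_descends (reg i)).
  pose q w := \row_i Q i w.
  have qE m' : V m' -> \row_i r i m' = q (quotient_coord m').
    by move=> Vm'; apply/rowP => i; rewrite !mxE (HQ i).2 //; exact: sV.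
  have dq w : differentiable q w by apply: differentiable_row => i; exact: (HQ i).1.
  have gE : \forall w \near quotient_coord m, (H \o q) w = g w.
    have : nbhs (quotient_coord m) (quotient_coord @` V).
      by apply: open_nbhs_nbhs; split; [apply/quotient_open|exists m].
    by apply: filterS => _ [m' Vm' <-]; have [_ e] := E _ Vm'; rewrite /comp -qE.
  apply: near_eq_differentiable gE _; apply: differentiable_comp; first exact: dq.
  by apply: dH; rewrite -qE //; have [] := E _ Vm.
(* X and Y are themselves regular, so U and these two functions present g globally; [p] only turns a
   row of length 2 into a pair. *)
pose r (i : 'I_2) (m : set (set (triple R))) :=
  if i == ord0 then (quotient_coord m).1 else (quotient_coord m).2.
pose p (v : 'rV[C]_2) := (v ord0 ord0, v ord0 ord_max).
have dp v : differentiable p v.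
  by apply: differentiable_pair; exact: differentiable_coord.
have pr m' : p (\row_i r i m') = quotient_coord m'.
  by rewrite /p !mxE /r eqxx /=; case: (quotient_coord m').
exists U, 2%N, r, (p @^-1` (quotient_coord @` U)), (g \o p); split; split => //.
- by move=> i; exact: coord_regular.
- apply: open_comp; last by apply/quotient_open.
  by move=> v _; exact: differentiable_continuous.
- move=> v Ov; apply: differentiable_comp; [exact: dp|exact: hol].
- move=> m' Um'; rewrite /preimage /comp /= pr; split => //; by exists m'.
Qed.

End Quotient.

Theorem corollary1p3 (R : realType) (n : nat) (hn : (2 <= n)%N) :
  set_bij (@moduli R n) (@hol_classes R n) (@underlying R) /\
  exists F : set (set (triple R)) -> Cplx R * Cplx R,
    (forall K : set (triple R), marked_moduli n K ->
       F (marking_orbit K) = (coordX n K, coordY1 n K + coordY2 n K)) /\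
    biholomorphic_C2 n F.
Proof.
split; first exact: underlying_bij (ltnW hn).
exists (@quotient_coord R n); split; first by move=> K; exact: quotient_coordE.
split; first exact: quotient_coord_bij.
  exact: quotient_open.
exact: quotient_holomorphic.
Qed.
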